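(* Let $z_1,z_2,\dots$ be independent random variables with $z_j\ge 0$, with means $\mu_j=\mathbb{E}(z_j)$ and variances $\sigma_j^2=\mathrm{Var}(z_j)$. Assume there are constants $0<\underline\mu\le\overline\mu<\infty$, $0<\underline\sigma^2\le\overline\sigma^2<\infty$, $\alpha>0$ and $M_\alpha<\infty$ such that for all $j\ge1$: $\underline\mu\le\mu_j\le\overline\mu$, $\underline\sigma^2\le\sigma_j^2\le\overline\sigma^2$, and $\mathbb{E}(z_j^{-\alpha})\le M_\alpha$. Let $p<1$ be a nonzero real number, and for $d\ge1$ let $f(\boldsymbol z)=\bigl(\sum_{j=1}^dz_j\big/\sum_{j=1}^d\mu_j\bigr)^p$ as a function of $\boldsymbol z=(z_1,\dots,z_d)$. Then the mean dimension of $f$ satisfies $$\lim_{d\to\infty}\nu(f)=1.$$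
   Context: Mean dimension: let $f$ be a function of $d$ independent random variables $\boldsymbol z=(z_1,\dots,z_d)$ with $0<\mathrm{Var}(f(\boldsymbol z))<\infty$. Its ANOVA decomposition is $f=\sum_{u\subseteq\{1,\dots,d\}}f_u$, where $f_u(\boldsymbol z)=\mathbb{E}(f(\boldsymbol z)\mid z_j, j\in u)-\sum_{v\subsetneq u}f_v(\boldsymbol z)$; the $f_u$ are mutually orthogonal, and $f_\varnothing=\mathbb{E}(f(\boldsymbol z))$. With $\sigma_u^2=\mathrm{Var}(f_u(\boldsymbol z))$ and $\sigma^2=\mathrm{Var}(f(\boldsymbol z))=\sum_u\sigma_u^2$, the mean dimension is $\nu(f)=\frac1{\sigma^2}\sum_{u}|u|\,\sigma_u^2$. Equivalently $\nu(f)=\frac1{\sigma^2}\sum_{j=1}^d\overline\tau_j^2$ with $\overline\tau_j^2=\sum_{u\ni j}\sigma_u^2=\mathbb{E}(\mathrm{Var}(f(\boldsymbol z)\mid z_\ell,\ell\ne j))$. Asymptotic statements as $d\to\infty$ concern all sufficiently large $d$, for which $f$ is square integrable. *)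

(* Defs.v *)
From HB Require Import structures.
From mathcomp Require Import all_boot all_order all_algebra.
From mathcomp Require Import finmap.
From mathcomp Require Import all_classical all_reals all_analysis.

Set Implicit Arguments.
Unset Strict Implicit.
Unset Printing Implicit Defensive.

Import Order.TTheory GRing.Theory Num.Theory.
Import numFieldNormedType.Exports.

Local Open Scope classical_set_scope.
Local Open Scope ring_scope.

Definition mutually_independent {d : measure_display} {T : measurableType d}
    {R : realType} (P : probability T R) (X : nat -> T -> R) : Prop :=
  forall (J : {fset nat}) (B : nat -> set R),
    (forall j, measurable (B j)) ->
    P (\bigcap_(j in [set` J]) (X j @^-1` B j)) =
    (\prod_(j <- J) P (X j @^-1` B j))%E.

Section conditional_expectation.
Context {d : measure_display} {T : measurableType d} {R : realType}.
Variable P : probability T R.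

Definition is_cond_exp (G : set (set T)) (Y g : T -> R) : Prop :=
  [/\ forall B : set R, measurable B -> G (g @^-1` B),
      P.-integrable [set: T] (EFin \o g) &
      forall A, G A ->
        (\int[P]_(w in A) (g w)%:E = \int[P]_(w in A) (Y w)%:E)%E].

(* A version of E(Y | G), which is unique up to almost sure equality. The
   default value 0 is only reached when no version exists; when Y is integrable
   and G is a sub-sigma-algebra, the Radon-Nikodym theorem provides one. *)
Definition cond_exp (G : set (set T)) (Y : T -> R) : T -> R :=
  xget (cst 0) [set g | is_cond_exp G Y g].

End conditional_expectation.

Section anova.
Context {d : measure_display} {T : measurableType d} {R : realType}.
Variables (P : probability T R) (n : nat) (X : 'I_n -> T -> R).

Definition sigma_of (u : {set 'I_n}) : set (set T) :=
  <<s \bigcup_(j in [set` u])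
        preimage_set_system [set: T] (X j) (@measurable _ R) >>.

Variable f : ('I_n -> R) -> R.

Definition eval_at : T -> R := fun w => f (fun j => X j w).

(* The recursion on proper subsets is driven by a bound k on the cardinal;
   [anova_effectE] below is the defining equation. *)
Fixpoint anova_rec (k : nat) (u : {set 'I_n}) : T -> R := fun w =>
  cond_exp P (sigma_of u) eval_at w -
  (if k is k'.+1 then
     \sum_(v : {set 'I_n} | v \proper u) anova_rec k' v w
   else 0).

Definition anova_effect (u : {set 'I_n}) : T -> R := anova_rec #|u| u.

Lemma anova_rec_stable (k : nat) (u : {set 'I_n}) : (#|u| <= k)%N ->
  anova_rec k u = anova_rec #|u| u.
Proof.
elim: k {-2}k (leqnn k) u => [|m IH] k lekm u leuk.
  by move: lekm leuk; rewrite leqn0 => /eqP ->; rewrite leqn0 => /eqP ->.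
apply/funext => w.
case: k lekm leuk => [_|k lekm leuk]; first by rewrite leqn0 => /eqP ->.
case cu : #|u| => [|c] /=; congr (_ - _).
  rewrite big_pred0 // => v; apply/negP => /proper_card.
  by rewrite cu ltn0.
apply: eq_bigr => v /proper_card; rewrite cu ltnS => vc.
have ck : (c <= k)%N by rewrite -ltnS -cu.
by rewrite (IH k) ?(IH c) // ?(leq_trans vc) // (leq_trans ck).
Qed.

Lemma anova_effectE (u : {set 'I_n}) (w : T) :
  anova_effect u w = cond_exp P (sigma_of u) eval_at w -
    \sum_(v : {set 'I_n} | v \proper u) anova_effect v w.
Proof.
rewrite {1}/anova_effect -(anova_rec_stable (leqnSn _)) /=; congr (_ - _).
apply: eq_bigr => v /proper_card vu.
by rewrite (anova_rec_stable (ltnW vu)).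
Qed.

(* Meaningful only if 0 < Var(f(X)) < +oo. *)
Definition mean_dimension : R :=
  (fine 'V_P[eval_at])^-1 *
  \sum_(u : {set 'I_n}) #|u|%:R * fine 'V_P[anova_effect u].

End anova.

Arguments eval_at {d T R n} X f _.

(* For p < 0 the library sets 0 `^ p = 0 and x `^ p = 1 for x < 0; in the
   application these values are only taken on a null event. *)
Definition power_of_sum {R : realType} (mu : nat -> R) (p : R) (n : nat)
    (x : 'I_n -> R) : R :=
  ((\sum_(j < n) x j) / (\sum_(j < n) mu j)) `^ p.

(* Main.v *)
(* For phi(x) = x^p with p < 1 and y > 0, Cauchy's mean value theorem gives
   phi(y + a) - phi(y + b) = c * (phi(1 + a) - phi(1 + b)) for all a, b >= 0,
   with c between 1 and y^(p-1).  Take y = y_j, the mean with z_j left out, and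
   a, b two values of z_j / m, m = sum_j mu_j.  With
   v_j = Var(phi(1 + z_j / m)), this yields
     sum_(u containing j) sigma_u^2 <= v_j * E(max(1, y_j^(p-1))^2),
     sigma_{j}^2 >= v_j * E(min(1, y_j^(p-1)))^2.
   Both expectations tend to 1 uniformly in j: y_j concentrates at 1 by
   Chebyshev, and the AM-GM inequality bounds the negative moments of y_j by
   products of those of the z_i.  Comparing with v_j instead of linearizing
   phi avoids any uniform integrability of the z_j^2.

   Since f is a function of the sum of the z_j, its conditional expectation
   given (z_j)_(j in u) is psi_u(sum_(j in u) z_j) for an explicit psi_u, and
   the covariance of two of them depends only on the intersection of the index
   sets; the ANOVA identities follow from this fact alone. *)

Require Import Defs.
From HB Require Import structures.
From mathcomp Require Import all_boot all_order all_algebra.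
From mathcomp Require Import finmap.
From mathcomp Require Import all_classical all_reals all_analysis.
From mathcomp Require Import measurable_realfun ring lra.

Set Implicit Arguments.
Unset Strict Implicit.
Unset Printing Implicit Defensive.

Import Order.TTheory GRing.Theory Num.Theory.
Import numFieldNormedType.Exports.

Local Open Scope classical_set_scope.
Local Open Scope ring_scope.

(** * Independence of coordinate sigma-algebras *)

(** If [a] and [b] bound the two expectations from above and below, the estimates add up to: sum_j
    of the total effects <= a * sum_j v_j, and Var f >= sum_j sigma_{j}^2 >= b^2 * sum_j v_j. Hence
    1 <= nu <= a / b^2, and the unknown v_j cancel. The increment identity speaks of differences of
    values, not of variances; averaging squared differences over two independent copies passes from
    one to the other. A negative moment of any order s is reached from the single order alpha
    because AM-GM over k variables gives each of them the exponent s / k, which is at most alpha for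
    large k. The k bounds M^(s / (k alpha)) multiply to M^(s / alpha), whatever k is. This is where
    d must be large. With the conditioning variables fixed, an integral over the others is known to
    be finite only almost surely. Conditional expectations are therefore extended-real integrals of
    nonnegative functions, and the inequalities between them are written with sums, so that no
    infinities are subtracted. *)

Section generated.
Context {disp : measure_display} {T : measurableType disp} {R : realType}.
Variables (P : probability T R) (n : nat) (X : 'I_n -> T -> R).
Implicit Types u v : {set 'I_n}.

Definition finitely_independent : Prop :=
  forall u (B : 'I_n -> set R), (forall j, measurable (B j)) ->
  P (\bigcap_(j in [set` u]) (X j @^-1` B j)) =
  (\prod_(j in u) P (X j @^-1` B j))%E.

Definition sigma_gen u : set (set T) :=
  \bigcup_(j in [set` u]) preimage_set_system [set: T] (X j) (@measurable _ R).

(** The carrier remains [T]; only the sigma-algebra shrinks. To depend measurably on the coordinates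
    in [u] becomes plain measurability on this type, so library results on product measures
    apply. *)
Definition sigma_type u := g_sigma_algebraType (sigma_gen u).

HB.instance Definition _ u := Measurable.on (sigma_type u).

Definition cylinder u : set (set T) :=
  [set \bigcap_(j in [set` u]) (X j @^-1` B j) | B in
    [set B : 'I_n -> set R | forall j, measurable (B j)]].

Lemma measurable_coord u j : j \in u ->
  measurable_fun [set: sigma_type u] (X j : sigma_type u -> R).
Proof.
move=> ju _ B mB; apply: sub_sigma_algebra; exists j => //.
by exists B.
Qed.

(** The generators in [sigma_gen u] constrain one coordinate each and are not stable under
    intersection. Cylinders are, as uniqueness of measures requires. *)
Lemma sigma_gen_cylinder u : <<s sigma_gen u >> = <<s cylinder u >>.
Proof.
apply/seteqP; split.
  apply: smallest_sub; first exact: smallest_sigma_algebra.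
  move=> _ [j ju [B mB <-]]; apply: sub_sigma_algebra.
  exists (fun i => if i == j then B else setT).
    by move=> i /=; case: ifP.
  rewrite setTI; apply/seteqP; split=> [w /(_ j ju)|w Bw i _] /=.
    by rewrite eqxx.
  by case: eqP => // ->.
apply: smallest_sub; first exact: smallest_sigma_algebra.
move=> _ [B mB <-].
have : measurable (\bigcap_(j in [set` u]) (X j @^-1` B j) : set (sigma_type u)).
  apply: fin_bigcap_measurable => // j ju.
  by rewrite -[_ @^-1` _]setTI; apply: measurable_coord.
by [].
Qed.

Lemma cylinder_setI u : setI_closed (cylinder u).
Proof.
move=> _ _ [B mB <-] [C mC <-]; exists (fun j => B j `&` C j).
  by move=> j; exact: measurableI.
apply/seteqP; split=> [w BC|w [Bw Cw] j ju]; last by split; [exact: Bw|exact: Cw].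
by split=> j ju; have [] := BC j ju.
Qed.

Lemma cylinderT u : cylinder u setT.
Proof.
exists (fun _ => setT) => //.
by apply/seteqP; split.
Qed.

Hypothesis mX : forall j, measurable_fun setT (X j).

Lemma cylinder_measurable u : cylinder u `<=` measurable.
Proof.
move=> _ [B mB <-]; apply: fin_bigcap_measurable => // j ju.
by rewrite -[_ @^-1` _]setTI; apply: mX.
Qed.

Lemma sigma_gen_measurable u : <<s sigma_gen u >> `<=` (@measurable _ T).
Proof.
rewrite sigma_gen_cylinder; apply: smallest_sub.
  exact: sigma_algebra_measurable.
exact: cylinder_measurable.
Qed.

Hypothesis indep : finitely_independent.

Lemma cylinder_indep u v A B : u \subset ~: v -> cylinder u A -> cylinder v B ->
  P (A `&` B) = (P A * P B)%E.
Proof.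
move=> uv [C mC <-] [D mD <-].
(* As [u] and [v] are disjoint, one family [E] describes both cylinders, and independence is applied
   to it on [u], on [v] and on their union. *)
pose E j := if j \in u then C j else D j.
have EC : \bigcap_(j in [set` u]) (X j @^-1` C j) =
          \bigcap_(j in [set` u]) (X j @^-1` E j).
  by apply: eq_bigcapr => j /= ju; rewrite /E ju.
have ED : \bigcap_(j in [set` v]) (X j @^-1` D j) =
          \bigcap_(j in [set` v]) (X j @^-1` E j).
  apply: eq_bigcapr => j /= jv; rewrite /E; case: ifPn => // ju.
  by have := fintype.subsetP uv _ ju; rewrite inE jv.
have mE j : measurable (E j) by rewrite /E; case: ifP.
rewrite EC ED -bigcap_setU.
have -> : [set` u] `|` [set` v] = [set` u :|: v].
  apply/seteqP; split=> j /=; rewrite inE; last by move=> /orP.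
  by move=> [->|->]; rewrite ?orbT.
rewrite !indep// (eq_bigl [predU u & v]); last by move=> j; rewrite !inE.
by rewrite bigU//= finset.disjoints_subset.
Qed.

(** For fixed [B], both sides are finite measures in [A]; they agree on the pi-system of cylinders,
    hence on the sigma-algebra it generates. *)
Let mrestr_unique u B (mB : measurable B) :
  (forall A, cylinder u A -> P (A `&` B) = (P A * P B)%E) ->
  forall A, <<s sigma_gen u >> A -> P (A `&` B) = (P A * P B)%E.
Proof.
move=> H A; rewrite sigma_gen_cylinder => sA.
have pB0 : (0 <= fine (P B)) by exact: fine_ge0.
have PB : P B = (fine (P B))%:E by rewrite fineK// fin_num_measure.
have := @g_sigma_algebra_measure_unique _ _ _ (cylinder u)
  (@cylinder_measurable u) (fun _ => setT) (fun _ => cylinderT u) _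
  (mrestr P mB) (mscale (NngNum pB0) P) (@cylinder_setI u) _ _ A sA.
rewrite /= /mrestr /mscale /= -PB muleC; apply.
- exact: bigcup_const.
- by move=> C cC /=; rewrite H// muleC.
- move=> _; rewrite setTI.
  by rewrite (le_lt_trans (probability_le1 _ _))// ltry.
Qed.

(** The extension from cylinders is used twice: once in [A] with [B] fixed, then in [B] with the
    first set already a cylinder. *)
Lemma sigma_indep u v A B : u \subset ~: v ->
  <<s sigma_gen u >> A -> <<s sigma_gen v >> B -> P (A `&` B) = (P A * P B)%E.
Proof.
move=> uv sA sB; apply: (@mrestr_unique u) => //.
  exact: sigma_gen_measurable sB.
move=> C cC; rewrite setIC muleC; apply: (@mrestr_unique v) => //.
  exact: cylinder_measurable cC.
by move=> D cD; rewrite setIC muleC; apply: cylinder_indep cC cD.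
Qed.

Lemma measurable_id_sigma u : measurable_fun [set: T] (idfun : T -> sigma_type u).
Proof.
move=> _ A mA; rewrite setTI; exact: sigma_gen_measurable mA.
Qed.

Lemma measurable_from_sigma u dd (U : measurableType dd) (g : T -> U) :
  measurable_fun [set: sigma_type u] (g : sigma_type u -> U) ->
  measurable_fun setT g.
Proof. by move=> mg; exact: (measurableT_comp mg (@measurable_id_sigma u)). Qed.

(* The law of [w |-> (w, w)] on the product of the sigma-algebras of [u] and [v]
   is the product measure. *)
Lemma decouple u v (K : sigma_type u * sigma_type v -> \bar R) : u \subset ~: v ->
  measurable_fun setT K ->
  (forall x, 0 <= K x)%E ->
  (\int[P]_w K (w, w) = \int[P]_w \int[P]_w' K (w, w'))%E.
Proof.
move=> uv mK K0.
have mid u' := @measurable_id_sigma u'.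
pose iu : {mfun T >-> sigma_type u} := mfun_Sub (mem_set (mid u)).
pose iv : {mfun T >-> sigma_type v} := mfun_Sub (mem_set (mid v)).
have mdg : measurable_fun setT (fun w : T => (w, w) : sigma_type u * sigma_type v).
  by apply: measurable_fun_pair; exact: mid.
pose dg : {mfun T >-> (sigma_type u * sigma_type v)%type} :=
  mfun_Sub (mem_set mdg).
transitivity (\int[distribution P dg]_x K x)%E.
  by rewrite ge0_integral_distribution.
(* Two measures on the product are compared on rectangles: the diagonal map pulls [B] x [C] back to
   the intersection of [B] and [C], whose probability factors. *)
transitivity (\int[distribution P iu \x distribution P iv]_x K x)%E.
  apply: eq_measure_integral => A mA _; symmetry.
  apply: product_measure_unique => // B C mB mC.
  rewrite /= /distribution /pushforward /=.
  have -> : (fun w : T => (w, w)) @^-1` (B `*` C) = B `&` C by [].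
  by rewrite (sigma_indep uv).
rewrite fubini_tonelli1//= ge0_integral_distribution//=; last 2 first.
- exact: measurable_fun_fubini_tonelli_F.
- by move=> y; rewrite integral_ge0.
apply: eq_integral => w _; rewrite /= /fubini_F ge0_integral_distribution//.
exact: measurableT_comp.
Qed.

End generated.

(** * Square-integrable random variables *)

Section square_integrable.
Context {disp : measure_display} {T : measurableType disp} {R : realType}.
Variable P : probability T R.
Implicit Types X Y : T -> R.
Local Open Scope ereal_scope.

Lemma Lfun2P X : measurable_fun setT X -> \int[P]_w (X w ^+ 2)%:E < +oo ->
  X \in Lfun P 2%:E.
Proof.
move=> mX X2; rewrite inE; apply/andP; split; rewrite inE/=; first exact: mX.
rewrite /finite_norm unlock /= poweR_lty//.
apply: le_lt_trans X2; rewrite le_eqVlt; apply/orP; left; apply/eqP.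
by apply: eq_integral => w _; rewrite /= powR_mulrn ?normr_ge0// real_normK ?num_real.
Qed.

Lemma Lfun2_measurable X : X \in Lfun P 2%:E -> measurable_fun setT X.
Proof. by rewrite inE => /andP[]; rewrite inE. Qed.

Lemma Lfun2_lty X : X \in Lfun P 2%:E -> \int[P]_w (X w ^+ 2)%:E < +oo.
Proof. by move=> /Lfun2_integrable_sqr /integrable_lty -> //. Qed.

Lemma Lfun21 X : X \in Lfun P 2%:E -> X \in Lfun P 1.
Proof. by apply: Lfun_subset12; exact: fin_num_measure. Qed.

Lemma covariance2E X Y : X \in Lfun P 2%:E -> Y \in Lfun P 2%:E ->
  covariance P X Y =
  \int[P]_w (X w * Y w)%:E - (\int[P]_w (X w)%:E) * (\int[P]_w (Y w)%:E).
Proof.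
move=> X2 Y2.
rewrite (covarianceE (Lfun21 X2) (Lfun21 Y2) (Lfun2_mul_Lfun1 X2 Y2)).
by rewrite !unlock.
Qed.

Lemma covariance_fin X Y : X \in Lfun P 2%:E -> Y \in Lfun P 2%:E ->
  covariance P X Y \is a fin_num.
Proof.
move=> X2 Y2.
exact: (covariance_fin_num (Lfun21 X2) (Lfun21 Y2) (Lfun2_mul_Lfun1 X2 Y2)).
Qed.

Lemma ae_eq_EFin X Y (D : set T) : {ae P, forall w, X w = Y w} ->
  ae_eq P D (EFin \o X) (EFin \o Y).
Proof. by apply: filterS => w XY _ /=; rewrite XY. Qed.

Lemma Lfun2_ae X Y : measurable_fun setT Y -> {ae P, forall w, X w = Y w} ->
  X \in Lfun P 2%:E -> Y \in Lfun P 2%:E.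
Proof.
move=> mY XY X2; apply: Lfun2P => //; apply: le_lt_trans (Lfun2_lty X2).
rewrite le_eqVlt; apply/orP; left; apply/eqP.
apply: ge0_ae_eq_integral => //.
- by apply/measurable_EFinP; exact: measurable_funX.
- apply/measurable_EFinP; apply: measurable_funX; exact: Lfun2_measurable.
- by move=> w _; rewrite lee_fin sqr_ge0.
- by move=> w _; rewrite lee_fin sqr_ge0.
- by apply: filterS XY => w -> _.
Qed.

Lemma covariance_ae X X' Y Y' : X \in Lfun P 2%:E -> Y \in Lfun P 2%:E ->
  X' \in Lfun P 2%:E -> Y' \in Lfun P 2%:E ->
  {ae P, forall w, X w = X' w} -> {ae P, forall w, Y w = Y' w} ->
  covariance P X Y = covariance P X' Y'.
Proof.
move=> X2 Y2 X'2 Y'2 XX' YY'; rewrite !covariance2E//.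
have m := @Lfun2_measurable.
congr (_ - _ * _); apply: ae_eq_integral => //.
- by apply/measurable_EFinP/measurable_funM; exact: m.
- by apply/measurable_EFinP/measurable_funM; exact: m.
- by apply: filterS2 XX' YY' => w -> -> _.
- by apply/measurable_EFinP; exact: m.
- by apply/measurable_EFinP; exact: m.
- exact: ae_eq_EFin.
- by apply/measurable_EFinP; exact: m.
- by apply/measurable_EFinP; exact: m.
- exact: ae_eq_EFin.
Qed.

Lemma covariance_suml (I : eqType) (r : seq I) (p : pred I) (X : I -> T -> R) Y :
  (forall i, p i -> X i \in Lfun P 2%:E) -> Y \in Lfun P 2%:E ->
  fine (covariance P (fun w => \sum_(i <- r | p i) X i w)%R Y) =
  (\sum_(i <- r | p i) fine (covariance P (X i) Y))%R.
Proof.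
move=> X2 Y2.
suff [] : (fun w => \sum_(i <- r | p i) X i w)%R \in Lfun P 2%:E /\
   fine (covariance P (fun w => \sum_(i <- r | p i) X i w)%R Y) =
  (\sum_(i <- r | p i) fine (covariance P (X i) Y))%R by [].
elim: r => [|i r [IH1 IH2]].
  rewrite big_nil.
  have -> : (fun w => \sum_(i <- [::] | p i) X i w)%R = cst 0%R :> (T -> R).
    by apply/funext => w; rewrite big_nil.
  split; first exact: Lfun_cst.
  by rewrite covariance_cst_l.
rewrite big_cons; case: ifPn => pi; last first.
  suff -> : (fun w => \sum_(j <- i :: r | p j) X j w)%R =
            (fun w => \sum_(j <- r | p j) X j w)%R by split.
  by apply/funext => w; rewrite big_cons (negbTE pi).
have -> : (fun w => \sum_(j <- i :: r | p j) X j w)%R =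
          (X i \+ fun w => \sum_(j <- r | p j) X j w)%R.
  by apply/funext => w; rewrite big_cons pi.
split; first by rewrite rpredD ?lee1n//= => _; exact: X2.
by rewrite covarianceDl ?X2// fineD ?IH2 ?covariance_fin ?X2.
Qed.

Lemma Lfun2_sum (I : eqType) (r : seq I) (p : pred I) (X : I -> T -> R) :
  (forall i, p i -> X i \in Lfun P 2%:E) ->
  (fun w => \sum_(i <- r | p i) X i w)%R \in Lfun P 2%:E.
Proof.
move=> X2.
have -> : (fun w => \sum_(i <- r | p i) X i w)%R = (\sum_(i <- r | p i) X i)%R.
  by apply/funext => w; rewrite fct_sumE.
by rewrite rpred_sum ?lee1n// => _ i pi; exact: X2.
Qed.

(** This is the nonnegativity of the variance; an infinite second moment makes the bound trivial. *)
Lemma sqr_integral_le X : measurable_fun setT X -> (forall w, (0 <= X w)%R) ->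
  (\int[P]_w (X w)%:E) ^+ 2 <= \int[P]_w (X w ^+ 2)%:E.
Proof.
move=> mX X0; have [Xoo|] := ltP (\int[P]_w (X w ^+ 2)%:E) +oo; last first.
  by rewrite leye_eq => /eqP ->; rewrite leey.
have X2 := Lfun2P mX Xoo.
have fX : \int[P]_w (X w)%:E \is a fin_num.
  by apply: integrable_fin_num => //; apply/Lfun1_integrable; exact: Lfun21.
by have := variance_ge0 P X; rewrite varianceE// unlock sube_ge0// fin_numX.
Qed.

End square_integrable.

Section variance_facts.
Context {disp : measure_display} {T : measurableType disp} {R : realType}.
Variable P : probability T R.
Implicit Types X Y : T -> R.
Local Open Scope ereal_scope.

Lemma Lfun2_Lfun1_fine X : X \in Lfun P 2%:E ->
  \int[P]_w (X w)%:E = (fine (\int[P]_w (X w)%:E))%:E.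
Proof.
move=> X2; rewrite fineK//; apply: integrable_fin_num => //.
by apply/Lfun1_integrable; exact: Lfun21.
Qed.

Lemma variance_fine X : X \in Lfun P 2%:E -> 'V_P[X] = (fine 'V_P[X])%:E.
Proof. by move=> X2; rewrite fineK// variance_fin_num. Qed.

Lemma expectationE X : 'E_P[X] = \int[P]_w (X w)%:E.
Proof. by rewrite unlock. Qed.

Lemma integral_sqrB X (a : R) : X \in Lfun P 2%:E ->
  \int[P]_w ((X w - a) ^+ 2)%:E =
  (fine 'V_P[X] + (fine (\int[P]_w (X w)%:E) - a) ^+ 2)%:E.
Proof.
move=> X2.
have Xa2 : (X \- cst a)%R \in Lfun P 2%:E.
  by rewrite rpredB ?lee1n//= => _; exact: Lfun_cst.
have EXa : \int[P]_w ((X \- cst a)%R w)%:E = (fine (\int[P]_w (X w)%:E) - a)%:E.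
  have := expectationB (Lfun21 X2) (Lfun21 (Lfun_cst P a 2)).
  by rewrite expectation_cst unlock => ->; rewrite EFinB -Lfun2_Lfun1_fine.
have V : 'V_P[X] = \int[P]_w ((X w - a) ^+ 2)%:E - (fine (\int[P]_w (X w)%:E) - a)%:E ^+ 2.
  rewrite -(varianceB_cst_r a X2) varianceE//.
  by rewrite !expectationE EXa.
have fin : \int[P]_w ((X w - a) ^+ 2)%:E \is a fin_num.
  rewrite ge0_fin_numE; first exact: (Lfun2_lty Xa2).
  by apply: integral_ge0 => w _; rewrite lee_fin sqr_ge0.
have -> : fine 'V_P[X] = (fine (\int[P]_w ((X w - a) ^+ 2)%:E) -
    (fine (\int[P]_w (X w)%:E) - a) ^+ 2)%R.
  by rewrite V -(fineK fin) -EFin_expe -EFinB.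
by rewrite subrK fineK.
Qed.

(* Integrate the pointwise bound over independent copies: the double integral
   of [(X w - X w')^2] is twice the variance of [X]. *)
Lemma variance_lipschitz X Y (c : R) : X \in Lfun P 2%:E -> Y \in Lfun P 2%:E ->
  {ae P, forall w, {ae P, forall w', (`|X w - X w'| <= c * `|Y w - Y w'|)%R}} ->
  (fine 'V_P[X] <= c ^+ 2 * fine 'V_P[Y])%R.
Proof.
move=> X2 Y2 H.
have mX := Lfun2_measurable X2; have mY := Lfun2_measurable Y2.
have c2 : (0 <= c ^+ 2)%R by exact: sqr_ge0.
set vX := fine 'V_P[X]; set vY := fine 'V_P[Y].
have vX0 : (0 <= vX)%R by rewrite fine_ge0 ?variance_ge0.
have vY0 : (0 <= vY)%R by rewrite fine_ge0 ?variance_ge0.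
pose eX := fine (\int[P]_w (X w)%:E); pose eY := fine (\int[P]_w (Y w)%:E).
(* Integrating over [w'] first: by [integral_sqrB] with [a] equal to [X w], the inner integral is
   the variance plus the squared deviation of [X w] from the mean. *)
have H1 : {ae P, forall w, (vX + (X w - eX) ^+ 2 <= c ^+ 2 * (vY + (Y w - eY) ^+ 2))%R}.
  apply: filterS H => w Hw; rewrite -lee_fin EFinM.
  rewrite -sqrrN opprB -integral_sqrB// -(sqrrN (Y w - eY)) opprB -integral_sqrB//.
  rewrite -ge0_integralZl//; last 2 first.
  - by apply/measurable_EFinP; apply: measurable_funX; exact: measurable_funB.
  - by move=> w' _; rewrite lee_fin sqr_ge0.
  apply: ae_ge0_le_integral => //.
  - by move=> w' _; rewrite lee_fin sqr_ge0.
  - by apply/measurable_EFinP; apply: measurable_funX; exact: measurable_funB.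
  - by move=> w' _; rewrite -EFinM lee_fin mulr_ge0 ?sqr_ge0.
  - apply: emeasurable_funM => //; apply/measurable_EFinP.
    by apply: measurable_funX; exact: measurable_funB.
  apply: filterS Hw => w' Hw' _; rewrite -EFinM lee_fin.
  rewrite -(real_normK (num_real (X w' - X w))) -(real_normK (num_real (Y w' - Y w))).
  rewrite -exprMn distrC (distrC (Y w')).
  rewrite lerXn2r// nnegrE// (le_trans _ Hw')//.
have meas (v a : R) (Z : T -> R) : measurable_fun setT Z ->
    measurable_fun setT (fun w => (v + (Z w - a) ^+ 2)%:E).
  move=> mZ; apply/measurable_EFinP; apply: measurable_funD => //.
  by apply: measurable_funX; exact: measurable_funB.
(* The outer integral turns the squared deviation into a second copy of the variance; the resulting
   factor 2 cancels at the end. *)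
have I Z : Z \in Lfun P 2%:E ->
    \int[P]_w (fine 'V_P[Z] + (Z w - fine (\int[P]_w (Z w)%:E)) ^+ 2)%:E =
    (fine 'V_P[Z] + fine 'V_P[Z])%:E.
  move=> Z2; under eq_integral do rewrite EFinD.
  rewrite ge0_integralD//=.
  - rewrite integral_cst//= probability_setT mule1 integral_sqrB//.
    by rewrite subrr expr0n/= addr0.
  - by move=> w _; rewrite lee_fin fine_ge0 ?variance_ge0.
  - by move=> w _; rewrite lee_fin sqr_ge0.
  - apply/measurable_EFinP; apply: measurable_funX; apply: measurable_funB => //.
    exact: (Lfun2_measurable Z2).
have : \int[P]_w (vX + (X w - eX) ^+ 2)%:E <=
       \int[P]_w ((c ^+ 2)%:E * (vY + (Y w - eY) ^+ 2)%:E).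
  apply: ae_ge0_le_integral => //.
  - by move=> w _; rewrite lee_fin addr_ge0 ?sqr_ge0.
  - exact: meas.
  - by move=> w _; rewrite -EFinM lee_fin mulr_ge0// addr_ge0 ?sqr_ge0.
  - by apply: emeasurable_funM => //; exact: meas.
  - by apply: filterS H1 => w Hw _; rewrite -EFinM lee_fin.
rewrite ge0_integralZl//; last 2 first.
- exact: meas.
- by move=> w _; rewrite lee_fin addr_ge0 ?sqr_ge0.
rewrite I// I// -EFinM lee_fin -!mulr2n mulrnAr.
by rewrite ler_pMn2r.
Qed.

Lemma variance0_ae X : X \in Lfun P 2%:E -> fine 'V_P[X] = 0%R ->
  exists a, {ae P, forall w, X w = a}.
Proof.
move=> X2 V0; exists (fine (\int[P]_w (X w)%:E)).
have := integral_sqrB (fine (\int[P]_w (X w)%:E)) X2.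
set a := fine _; rewrite V0 subrr expr0n/= addr0 => I0.
have mX := Lfun2_measurable X2.
have mf : measurable_fun setT (fun w => ((X w - a) ^+ 2)%:E).
  by apply/measurable_EFinP; apply: measurable_funX; exact: measurable_funB.
have [h _] := ae_eq_integral_abs P measurableT mf.
have : ae_eq P setT (fun w => ((X w - a) ^+ 2)%:E) (cst 0).
  apply: h; rewrite -[RHS]I0; apply: eq_integral => w _.
  by rewrite gee0_abs// lee_fin sqr_ge0.
apply: filterS => w /(_ I) /= [] /eqP.
by rewrite sqrf_eq0 subr_eq0 => /eqP.
Qed.

Lemma variance_ae_cst X (a : R) : X \in Lfun P 2%:E -> {ae P, forall w, X w = a} ->
  fine 'V_P[X] = 0%R.
Proof.
move=> X2 Xa; rewrite /variance (covariance_ae X2 X2 (Lfun_cst _ a _) (Lfun_cst _ a _))//.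
by rewrite covariance_cst_l.
Qed.

End variance_facts.

(** * ANOVA of functions of a sum *)

Section mobius.
Variables (R : realDomainType) (I : finType).
Variables (m : {set I} -> {set I} -> R) (q : {set I} -> R).
Implicit Types u v w a b : {set I}.
Hypothesis m_sym : forall u v, m u v = m v u.
Hypothesis m_sum : forall u v,
  \sum_(a : {set I} | a \subset u) \sum_(b : {set I} | b \subset v) m a b = q (u :&: v).

Lemma sum_subsetD1 (F : {set I} -> R) u :
  \sum_(a : {set I} | a \subset u) F a =
  F u + \sum_(a : {set I} | a \proper u) F a.
Proof.
rewrite (bigD1 u)//=; congr (_ + _); apply: eq_bigl => a.
by rewrite finset.properEneq andbC.
Qed.

Let K u b := \sum_(c : {set I} | c \subset b) m u c.

(** Summing [K] in its first argument over the subsets of [u], or over those of [u :&: b], gives the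
    same value [q (u :&: b)]. By induction the proper subsets of [u] outside [b] contribute nothing,
    so the only excess term, [K u b], is 0. *)
Let K0 u b : ~~ (u \subset b) -> K u b = 0.
Proof.
have [k] := ubnP #|u|; elim: k u => // k IH u; rewrite ltnS => uk ub.
have H1 : \sum_(a : {set I} | a \subset u) K a b = q (u :&: b) by exact: m_sum.
have H2 : \sum_(a : {set I} | a \subset u :&: b) K a b = q (u :&: b).
  by rewrite m_sum -finset.setIA finset.setIid.
rewrite sum_subsetD1 in H1.
suff H3 : \sum_(a : {set I} | a \proper u) K a b =
          \sum_(a : {set I} | a \subset u :&: b) K a b.
  by apply: (@addIr _ (q (u :&: b))); rewrite add0r -{1}H2 -H3.
rewrite (bigID (fun a => a \subset b))/= [X in _ + X]big1 ?addr0; last first.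
  move=> a /andP[au ab]; apply: IH => //.
  exact: leq_trans (proper_card au) _.
apply: eq_bigl => a; rewrite finset.subsetI finset.properEneq.
case: (boolP (a \subset b)) => ab; rewrite ?andbF// andbT.
suff -> : a != u by rewrite andbT.
by apply: contraNneq ub => <-.
Qed.

(** Peels the second argument: no subset of [v] contains [u], so by induction [K u v] reduces to its
    top term [m u v]. *)
Let m0 u v : ~~ (u \subset v) -> m u v = 0.
Proof.
have [k] := ubnP #|v|; elim: k v => // k IH v; rewrite ltnS => vk uv.
have := K0 uv; rewrite /K sum_subsetD1 big1 ?addr0// => c cv; apply: IH.
  exact: leq_trans (proper_card cv) _.
by apply: contra uv => /fintype.subset_trans -> //; exact: fintype.proper_sub.
Qed.

(* [m] is the matrix of covariances of the ANOVA effects: it is diagonal as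
   soon as the covariances of the conditional expectations depend only on the
   intersection of the index sets. *)
Lemma orthogonal_sum w : \sum_(u : {set I} | u \subset w) m u u = q w.
Proof.
rewrite -[in RHS](finset.setIid w) -m_sum; apply: eq_bigr => u uw.
rewrite (bigD1 u)//= big1 ?addr0// => v /andP[_ vu].
have [uv|] := boolP (u \subset v); last exact: m0.
(* Here [u] is a proper subset of [v], so [v] is not contained in [u] and the transposed entry
   vanishes. *)
rewrite m_sym m0//; apply: contra vu => vu.
by rewrite finset.eqEsubset vu uv.
Qed.

(** Count |u| as a sum over its elements and exchange the sums. The diagonal terms with j in u are
    all of them less those supported in the complement of j, that is, the total effect of variable
    j. *)
Lemma weighted_orthogonal_sum :
  \sum_(u : {set I}) #|u|%:R * m u u = \sum_(j : I) (q [set: I]%SET - q (~: [set j]%SET)).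
Proof.
under eq_bigr => u _.
  rewrite mulr_natl -sumr_const big_mkcond /=.
  over.
rewrite exchange_big /=; apply: eq_bigr => j _.
rewrite -!orthogonal_sum [X in X - _](eq_bigl xpredT); last first.
  by move=> u; rewrite finset.subsetT.
rewrite -big_mkcond /= [X in X - _](bigID (fun u => j \in u))/= addrC.
rewrite [X in _ - X](eq_bigl (fun u => j \notin u)); first by rewrite addrAC subrr add0r.
by move=> u; rewrite -finset.disjoints_subset fintype.disjoint_sym disjoints1.
Qed.

(** As the empty set has weight 0, [q] at a singleton is a single diagonal entry; distinct
    singletons give distinct entries of the full nonnegative sum. *)
Lemma ge0_singleton_sum : (forall u, 0 <= m u u) -> q finset.set0 = 0 ->
  \sum_(j : I) q [set j]%SET <= q [set: I]%SET.
Proof.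
move=> m_ge0 q0.
have mset0 : m finset.set0 finset.set0 = 0.
  by rewrite -q0 -orthogonal_sum (eq_bigl (pred1 finset.set0)) ?big_pred1_eq// => u; rewrite finset.subset0.
have q1 j : q [set j]%SET = m [set j]%SET [set j]%SET.
  rewrite -orthogonal_sum (bigD1 [set j]%SET)//= (bigD1 finset.set0)/=; last first.
    by rewrite finset.sub0set eq_sym; apply/finset.set0Pn; exists j; rewrite inE.
  rewrite mset0 add0r big1 ?addr0// => u /andP[/andP[]].
  by rewrite finset.subset1 => /orP[/eqP->|/eqP->]; rewrite eqxx.
rewrite (eq_bigr _ (fun j _ => q1 j)) -[X in _ <= X]orthogonal_sum.
have -> : \sum_(j : I) m [set j]%SET [set j]%SET =
    \sum_(u in [set [set j]%SET | j in [set: I]%SET]%SET) m u u.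
  rewrite big_imset; last by move=> i j _ _ /finset.set1_inj.
  by apply: eq_bigl => j; rewrite inE.
rewrite [leRHS](bigID (mem [set [set j]%SET | j in [set: I]%SET]%SET))/=.
rewrite [X in _ <= X + _](eq_bigl (mem [set [set j]%SET | j in [set: I]%SET]%SET)); last first.
  by move=> u; rewrite finset.subsetT.
by rewrite lerDl sumr_ge0.
Qed.

(** Source of the bound nu >= 1: nonempty sets have weight at least 1, and the empty one carries no
    variance. *)
Lemma total_le_weighted : (forall u, 0 <= m u u) -> q finset.set0 = 0 ->
  q [set: I]%SET <= \sum_(u : {set I}) #|u|%:R * m u u.
Proof.
move=> m_ge0 q0; rewrite -orthogonal_sum.
have mset0 : m finset.set0 finset.set0 = 0.
  by rewrite -q0 -orthogonal_sum (eq_bigl (pred1 finset.set0)) ?big_pred1_eq// => u; rewrite finset.subset0.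
rewrite (eq_bigl xpredT); last by move=> u; rewrite finset.subsetT.
apply: ler_sum => u _; have [->|/finset.set0Pn[j ju]] := eqVneq u finset.set0.
  by rewrite mset0 mulr0.
by rewrite ler_peMl// ler1n card_gt0; apply/finset.set0Pn; exists j.
Qed.

End mobius.

(** * Conditional expectations of a function of an independent sum *)

Section partial_sums.
Context {disp : measure_display} {T : measurableType disp} {R : realType}.
Variables (P : probability T R) (n : nat) (X : 'I_n -> T -> R).
Hypothesis mX : forall j, measurable_fun setT (X j).
Hypothesis indep : finitely_independent P X.
Implicit Types u v a : {set 'I_n}.
Local Open Scope ereal_scope.

Definition psum u (w : T) : R := (\sum_(j in u) X j w)%R.

Lemma psumU u v w : u \subset ~: v -> psum (u :|: v) w = (psum u w + psum v w)%R.
Proof.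
move=> uv; rewrite /psum (eq_bigl [predU u & v]); last by move=> j; rewrite !inE.
by rewrite bigU//= finset.disjoints_subset.
Qed.

Lemma measurable_psum u v : u \subset v ->
  measurable_fun [set: sigma_type X v] (psum u : sigma_type X v -> R).
Proof.
move=> uv; rewrite /psum.
have mXv j : measurable_fun [set: sigma_type X v]
    (fun w : sigma_type X v => if j \in u then X j w else 0%R).
  case: (boolP (j \in u)) => // ju; apply: measurable_coord; exact: (fintype.subsetP uv).
rewrite (_ : (fun w : sigma_type X v => _) =
  fun w => (\sum_(j < n) if j \in u then X j w else 0)%R); last first.
  by apply/funext => w; rewrite big_mkcond.
by apply: measurable_sum => j; exact: mXv.
Qed.

Lemma measurable_psumT u : measurable_fun setT (psum u).
Proof.
have uu : u \subset u by [].
exact: (measurable_from_sigma mX (measurable_psum uu)).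
Qed.

(** Freezing lemma: whatever depends on the coordinates in [u] may be held fixed while the sum over
    [v] is averaged. A general [Y] covers shifted sums as well as the zero shift. *)
Lemma decouple_sum u v (H : sigma_type X u -> \bar R) (Y : sigma_type X u -> R)
    (Phi : R -> \bar R) :
  u \subset ~: v -> measurable_fun setT H -> (forall w, 0 <= H w) ->
  measurable_fun setT Y -> measurable_fun setT Phi -> (forall s, 0 <= Phi s) ->
  \int[P]_w (H w * Phi (Y w + psum v w)%R) =
  \int[P]_w (H w * \int[P]_w' Phi (Y w + psum v w')%R).
Proof.
move=> uv mH H0 mY mPhi Phi0.
pose K (x : sigma_type X u * sigma_type X v) : \bar R :=
  H x.1 * Phi (Y x.1 + psum v x.2)%R.
have mP : measurable_fun [set: sigma_type X u * sigma_type X v]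
    (fun x : sigma_type X u * sigma_type X v => Y x.1 + psum v x.2)%R.
  apply: measurable_funD; first exact: measurableT_comp.
  by apply: measurableT_comp => //; exact: measurable_psum.
have mK : measurable_fun setT K.
  apply: emeasurable_funM; first exact: measurableT_comp.
  exact: measurableT_comp.
have K0 x : 0 <= K x by exact: mule_ge0.
rewrite (decouple mX indep uv mK K0).
apply: eq_integral => w _; rewrite /K/= ge0_integralZl//.
apply: measurableT_comp => //; apply: measurable_funD => //.
exact: measurable_psumT.
Qed.

Lemma measurable_shift v (Phi : R -> \bar R) : measurable_fun setT Phi ->
  (forall s, 0 <= Phi s) ->
  measurable_fun setT (fun s : R => \int[P]_w Phi (s + psum v w)%R).
Proof.
move=> mPhi Phi0; pose K (x : R * T) := Phi (x.1 + psum v x.2)%R.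
have mK : measurable_fun setT K.
  apply: measurableT_comp => //.
  apply: measurable_funD; first exact: measurable_fst.
  by apply: measurableT_comp => //; exact: measurable_psumT.
by apply: (@measurable_fun_fubini_tonelli_F _ _ _ _ _ P K) => // x; exact: Phi0.
Qed.

Lemma integral_psumT u (Phi : R -> \bar R) :
  measurable_fun setT Phi -> (forall s, 0 <= Phi s) ->
  \int[P]_w Phi (psum [set: 'I_n]%SET w) =
  \int[P]_w \int[P]_w' Phi (psum u w + psum (~: u) w')%R.
Proof.
move=> mPhi Phi0.
have uC : u \subset ~: ~: u by rewrite finset.setCK.
have uu : u \subset u by [].
transitivity (\int[P]_w (cst 1 w * Phi (psum u w + psum (~: u) w)%R)).
  by apply: eq_integral => w _; rewrite mul1e -psumU// finset.setUCr.
rewrite (decouple_sum uC (measurable_cst _) (fun=> lee01)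
  (measurable_psum uu) mPhi Phi0).
by apply: eq_integral => w _; rewrite mul1e.
Qed.

Variable h : R -> R.
Hypothesis mh : measurable_fun setT h.
Hypothesis h0 : forall s, (0 <= h s)%R.

(* By independence, [psi u (psum u w)] is E(h(sum of all X j) | X j, j in u). *)
Definition psi u (s : R) : \bar R := \int[P]_w (h (s + psum (~: u) w))%:E.

Lemma psi_ge0 u s : 0 <= psi u s.
Proof. by apply: integral_ge0 => w _; rewrite lee_fin. Qed.

Lemma measurable_psi u : measurable_fun setT (psi u).
Proof.
apply: (@measurable_shift (~: u) (fun s => (h s)%:E)) => [|s].
  exact/measurable_EFinP.
by rewrite lee_fin.
Qed.

(** Tower property: the complement of [a] splits into the disjoint blocks [u :\: a] and [~: u],
    which may be averaged one after the other. *)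
Lemma psi_tower a u s : a \subset u ->
  psi a s = \int[P]_w psi u (s + psum (u :\: a) w).
Proof.
move=> au.
have uaC : u :\: a \subset ~: ~: u by rewrite finset.setCK finset.subsetDl.
have E : ~: a = (u :\: a) :|: ~: u.
  apply/setP => j; rewrite !inE; case: (boolP (j \in a)) => //= ja.
    by rewrite (fintype.subsetP au).
  by case: (j \in u).
have := @decouple_sum (u :\: a) (~: u) (cst 1) (fun w => s + psum (u :\: a) w)%R
  (fun s => (h s)%:E) uaC (measurable_cst _).
move=> /(_ (fun=> lee01)).
have m1 : measurable_fun [set: sigma_type X (u :\: a)]
    (fun w : sigma_type X (u :\: a) => s + psum (u :\: a) w)%R.
  by apply: measurable_funD => //; exact: measurable_psum.
move=> /(_ m1); have mh' : measurable_fun setT (fun s => (h s)%:E) by exact/measurable_EFinP.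
move=> /(_ mh') D.
rewrite /psi E; under eq_integral do rewrite psumU// addrA -[_%:E]mul1e.
rewrite D => [|r]; last by rewrite lee_fin.
by apply: eq_integral => w _; rewrite mul1e.
Qed.

(** Against a weight depending on [v], the coordinates in [u :\: v] are independent of everything
    else in the integrand and average out; [psi_tower] recognizes the result. Both the covariances
    and the defining property of conditional expectation come from here. *)
Lemma psi_proj v u (H : sigma_type X v -> \bar R) :
  measurable_fun setT H -> (forall w, 0 <= H w) ->
  \int[P]_w (H w * psi u (psum u w)) =
  \int[P]_w (H w * psi (u :&: v) (psum (u :&: v) w)).
Proof.
move=> mH H0.
have uv : u :\: v \subset ~: v by rewrite finset.setDE finset.subsetIr.
have E w : psum u w = (psum (u :&: v) w + psum (u :\: v) w)%R.
  rewrite -psumU ?finset.setID//; apply/fintype.subsetP => j.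
  by rewrite !inE => /andP[_ ->].
have Dua : u :\: (u :&: v) = u :\: v.
  by apply/setP => j; rewrite !inE; case: (j \in u); rewrite ?andbF ?andbT.
under eq_integral do rewrite E.
have vu : v \subset ~: (u :\: v).
  by rewrite finset.setDE finset.setCI finset.setCK finset.subsetUr.
have := decouple_sum vu mH H0 (measurable_psum (finset.subsetIr u v))
  (measurable_psi u) (psi_ge0 u).
move=> ->; apply: eq_integral => w _; congr (_ * _).
by rewrite (psi_tower _ (finset.subsetIl u v)) Dua.
Qed.

Definition energy u : \bar R := \int[P]_w (psi u (psum u w) ^+ 2).

Lemma measurable_psi_psum u :
  measurable_fun [set: sigma_type X u] (fun w : sigma_type X u => psi u (psum u w)).
Proof.
apply: measurableT_comp; first exact: measurable_psi.
exact: measurable_psum.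
Qed.

(** Project twice, each factor serving in turn as the weight for the other. *)
Lemma psi_mul u v :
  \int[P]_w (psi u (psum u w) * psi v (psum v w)) = energy (u :&: v).
Proof.
have m1 := @measurable_psi_psum.
have p1 a w : 0 <= psi a (psum a w) by exact: psi_ge0.
transitivity (\int[P]_w (psi u (psum u w) * psi (v :&: u) (psum (v :&: u) w))).
  exact: psi_proj (m1 u) (p1 u).
transitivity (\int[P]_w (psi (v :&: u) (psum (v :&: u) w) * psi u (psum u w))).
  by apply: eq_integral => w _; rewrite muleC.
rewrite (psi_proj u (m1 (v :&: u)) (p1 (v :&: u))).
have -> : u :&: (v :&: u) = u :&: v.
  by rewrite (finset.setIC v) finset.setIA finset.setIid.
by rewrite (finset.setIC v).
Qed.

Lemma psiT s : psi [set: 'I_n]%SET s = (h s)%:E.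
Proof.
rewrite /psi; under eq_integral do rewrite finset.setCT /psum big_set0 addr0.
by rewrite integral_cst//= probability_setT mule1.
Qed.

(** This is [psi_proj] with the indicator of [A] as weight and the full index set, for which [psi]
    is [h] itself. *)
Lemma psi_cond v A : <<s sigma_gen X v >> A ->
  \int[P]_(w in A) psi v (psum v w) = \int[P]_(w in A) (h (psum [set: 'I_n]%SET w))%:E.
Proof.
move=> sA.
have mA : measurable (A : set (sigma_type X v)) by [].
rewrite [LHS]integral_mkcond [RHS]integral_mkcond.
transitivity (\int[P]_w ((\1_A w)%:E * psi v (psum v w))).
  by apply: eq_integral => w _; rewrite /= epatch_indic muleC.
transitivity (\int[P]_w ((\1_A w)%:E * psi [set: 'I_n]%SET (psum [set: 'I_n]%SET w))); last first.
  by apply: eq_integral => w _; rewrite /= epatch_indic muleC psiT.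
have m1 : measurable_fun [set: sigma_type X v] (fun w => (\1_A w)%:E : \bar R).
  by apply/measurable_EFinP; exact: measurable_indic.
have p1 w : 0 <= (\1_A w)%:E :> \bar R by rewrite lee_fin.
have := psi_proj [set: 'I_n]%SET m1 p1.
by rewrite finset.setTI => ->.
Qed.

(** Conditional Jensen: [sqr_integral_le] applied to the inner integral over the coordinates outside
    [u]. *)
Lemma energy_le u : energy u <= \int[P]_w (h (psum [set: 'I_n]%SET w) ^+ 2)%:E.
Proof.
pose Phi s : \bar R := (h s ^+ 2)%:E.
have mPhi : measurable_fun setT Phi.
  by apply/measurable_EFinP; exact: measurable_funX.
have Phi0 s : 0 <= Phi s by rewrite lee_fin sqr_ge0.
rewrite (integral_psumT u mPhi Phi0).
have m1 := measurable_from_sigma mX (@measurable_psi_psum u).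
have m2 := measurableT_comp (measurable_shift (~: u) mPhi Phi0) (@measurable_psumT u).
apply: ge0_le_integral => //.
- by move=> w _; exact: sqre_ge0.
- exact: (emeasurable_funM m1 m1).
- move=> w _; apply: sqr_integral_le => //.
  apply: measurableT_comp => //; apply: measurable_funD => //; exact: measurable_psumT.
Qed.

Definition total w : R := h (psum [set: 'I_n]%SET w).

Hypothesis total2 : \int[P]_w (total w ^+ 2)%:E < +oo.

Lemma measurable_total : measurable_fun setT total.
Proof. by apply: measurableT_comp => //; exact: measurable_psumT. Qed.

Lemma Lfun2_total : total \in Lfun P 2%:E.
Proof. exact: Lfun2P measurable_total total2. Qed.

Lemma integrable_total : P.-integrable setT (EFin \o total).
Proof. by apply/Lfun1_integrable; apply: Lfun21; exact: Lfun2_total. Qed.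

Lemma psi_mean u : \int[P]_w psi u (psum u w) = \int[P]_w (total w)%:E.
Proof. exact: (psi_cond (@measurableT _ (sigma_type X u))). Qed.

Lemma integrable_psi u : P.-integrable setT (fun w => psi u (psum u w)).
Proof.
apply/integrableP; split.
  exact: (measurable_from_sigma mX (@measurable_psi_psum u)).
under eq_integral do rewrite gee0_abs ?psi_ge0//.
rewrite psi_mean; apply: integrable_lty => //; exact: integrable_total.
Qed.

(** Real-valued version: [psi] may be infinite on a null event, where [fine] returns 0. *)
Definition cexp u w : R := fine (psi u (psum u w)).

Lemma cexpE u : {ae P, forall w, psi u (psum u w) = (cexp u w)%:E}.
Proof.
have := integrable_ae measurableT (integrable_psi u).
by apply: filterS => w /(_ I) fin; rewrite fineK.
Qed.

Lemma measurable_cexp u :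
  measurable_fun [set: sigma_type X u] (cexp u : sigma_type X u -> R).
Proof. by apply: measurableT_comp => //; exact: measurable_psi_psum. Qed.

Lemma measurable_cexpT u : measurable_fun setT (cexp u).
Proof. exact: (measurable_from_sigma mX (@measurable_cexp u)). Qed.

Lemma integral_cexp u (A : set T) : measurable A ->
  \int[P]_(w in A) (cexp u w)%:E = \int[P]_(w in A) psi u (psum u w).
Proof.
move=> mA; apply: ae_eq_integral => //.
- by apply: measurable_funTS; apply/measurable_EFinP; exact: measurable_cexpT.
- apply: measurable_funTS.
  exact: (measurable_from_sigma mX (@measurable_psi_psum u)).
- by apply: filterS (cexpE u) => w -> _.
Qed.

Lemma integral_cexpM u v :
  \int[P]_w (cexp u w * cexp v w)%:E = energy (u :&: v).
Proof.
rewrite -psi_mul; apply: ae_eq_integral => //.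
- apply/measurable_EFinP; apply: measurable_funM; exact: measurable_cexpT.
- apply: emeasurable_funM;
    exact: (measurable_from_sigma mX (@measurable_psi_psum _)).
- by apply: filterS2 (cexpE u) (cexpE v) => w -> -> _.
Qed.

Lemma energy_lty u : energy u < +oo.
Proof. exact: le_lt_trans (energy_le u) total2. Qed.

Lemma energy_fin u : energy u \is a fin_num.
Proof.
rewrite ge0_fin_numE ?energy_lty//.
by apply: integral_ge0 => w _; exact: sqre_ge0.
Qed.

Lemma Lfun2_cexp u : cexp u \in Lfun P 2%:E.
Proof.
apply: Lfun2P; first exact: measurable_cexpT.
by have := energy_lty u; rewrite -[in X in X -> _](finset.setIid u) -integral_cexpM.
Qed.

Lemma cexp_is_cond_exp u : is_cond_exp P (sigma_of X u) total (cexp u).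
Proof.
split.
- by move=> B mB; rewrite -[_ @^-1` _]setTI; exact: (@measurable_cexp u (@measurableT _ (sigma_type X u)) B mB).
- by apply/Lfun1_integrable; apply: Lfun21; exact: Lfun2_cexp.
- move=> A sA; rewrite integral_cexp; last exact: (sigma_gen_measurable mX sA).
  exact: psi_cond.
Qed.

(** The integrals are known to agree only on sets of the smaller sigma-algebra. Uniqueness is
    therefore invoked on [sigma_type X u] with [P] restricted to it (the law of the identity), and
    the null set is then read back in [T]. *)
Lemma cond_exp_unique u Y f g : is_cond_exp P (sigma_of X u) Y f ->
  is_cond_exp P (sigma_of X u) Y g -> {ae P, forall w, f w = g w}.
Proof.
move=> [mf fint fE] [mg gint gE].
pose iu : {mfun T >-> sigma_type X u} :=
  mfun_Sub (mem_set (measurable_id_sigma mX (u := u))).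
have m (k : T -> R) :
    (forall B : set R, measurable B -> sigma_of X u (k @^-1` B)) ->
    measurable_fun [set: sigma_type X u] (EFin \o k : sigma_type X u -> \bar R).
  by move=> mk; apply/measurable_EFinP => _ B mB; rewrite setTI; exact: mk.
have H : ae_eq (distribution P iu) setT (EFin \o f) (EFin \o g).
  apply: integral_ae_eq => //.
  - apply/integrableP; split; first exact: m.
    rewrite ge0_integral_distribution//; first by case/integrableP: fint.
    by apply: measurableT_comp => //; exact: m.
  - exact: m.
  - move=> E _ mE.
    have mE' : measurable (E : set T) by exact: (sigma_gen_measurable mX mE).
    have sub (k : T -> R) : P.-integrable setT (EFin \o k) ->
        P.-integrable (iu @^-1` E) ((EFin \o k) \o iu).
      by move=> ik; exact: integrableS measurableT mE' (@subsetT _ _) ik.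
    by rewrite !integral_pushforward//; [exact: etrans (fE _ mE) (esym (gE _ mE))|
      exact: m|exact: sub|exact: m|exact: sub].
case: H => N [mN N0 fgN]; exists N; split => //; first exact: (sigma_gen_measurable mX mN).
by move=> w /= fgw; apply: fgN => /= fg; apply: fgw; have [] := fg I.
Qed.

Variable f : ('I_n -> R) -> R.
Hypothesis fE : forall x, f x = h (\sum_j x j)%R.

Lemma eval_atE : eval_at X f = total.
Proof.
apply/funext => w; rewrite /eval_at fE /total /psum; congr h.
by apply: eq_bigl => j; rewrite inE.
Qed.

Let F u := cond_exp P (sigma_of X u) (eval_at X f).

Let F_is_cond_exp u : is_cond_exp P (sigma_of X u) total (F u).
Proof.
rewrite /F eval_atE /cond_exp.
apply: (@xgetPex _ (cst 0%R) [set g | is_cond_exp P (sigma_of X u) total g]).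
by exists (cexp u); exact: cexp_is_cond_exp.
Qed.

(** [cond_exp] picks an unspecified version; variances and covariances only see it up to null
    events, so it may be traded for the explicit [cexp]. *)
Let F_cexp u : {ae P, forall w, F u w = cexp u w}.
Proof. exact: cond_exp_unique (F_is_cond_exp u) (cexp_is_cond_exp u). Qed.

Let measurable_F u : measurable_fun setT (F u).
Proof.
have [mF _ _] := F_is_cond_exp u; move=> _ B mB; rewrite setTI.
exact: (sigma_gen_measurable mX (mF B mB)).
Qed.

Let Lfun2_F u : F u \in Lfun P 2%:E.
Proof.
apply: (Lfun2_ae (X := cexp u)); first exact: measurable_F.
  by apply: filterS (F_cexp u) => w ->.
exact: Lfun2_cexp.
Qed.

(* The variance of [cexp u], that is, of E(h(sum) | X j, j in u). *)
Definition cvar u : R := fine (energy u - (\int[P]_w (total w)%:E) ^+ 2).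

Lemma covariance_cexp u v : fine (covariance P (cexp u) (cexp v)) = cvar (u :&: v).
Proof. by rewrite covariance2E ?Lfun2_cexp// integral_cexpM !integral_cexp// !psi_mean. Qed.

Let covariance_F u v : fine (covariance P (F u) (F v)) = cvar (u :&: v).
Proof.
rewrite (covariance_ae (Lfun2_F u) (Lfun2_F v) (Lfun2_cexp u) (Lfun2_cexp v)
  (F_cexp u) (F_cexp v)).
exact: covariance_cexp.
Qed.

Let e u := anova_effect P X f u.

Let sum_e u w : (\sum_(a : {set 'I_n} | a \subset u) e a w)%R = F u w.
Proof.
by rewrite sum_subsetD1 /e anova_effectE subrK.
Qed.

Let Lfun2_e u : e u \in Lfun P 2%:E.
Proof.
have [k] := ubnP #|u|; elim: k u => // k IH u; rewrite ltnS => uk.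
rewrite (_ : e u = F u - fun w => \sum_(a : {set 'I_n} | a \proper u) e a w)%R; last first.
  by apply/funext => w; rewrite /e anova_effectE.
rewrite rpredB ?lee1n//= => _; apply: Lfun2_sum => a au; apply: IH.
exact: leq_trans (proper_card au) uk.
Qed.

Let m u v := fine (covariance P (e u) (e v)).

Let m_sym u v : m u v = m v u.
Proof. by rewrite /m covarianceC. Qed.

(** Supplies the hypothesis of the combinatorial section with [q] equal to [cvar]: by bilinearity,
    the effects on each side add up to conditional expectations. *)
Let m_sum u v :
  (\sum_(a : {set 'I_n} | a \subset u) \sum_(b : {set 'I_n} | b \subset v) m a b =
   cvar (u :&: v))%R.
Proof.
rewrite -covariance_F.
have FE u' : F u' = fun w => (\sum_(a : {set 'I_n} | a \subset u') e a w)%R.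
  by apply/funext => w; rewrite sum_e.
rewrite [in RHS](FE u) covariance_suml//; apply: eq_bigr => a _.
rewrite covarianceC [in RHS](FE v) covariance_suml//.
by apply: eq_bigr => b _; rewrite m_sym.
Qed.

Let m_ge0 u : (0 <= m u u)%R.
Proof. by rewrite /m fine_ge0//; exact: variance_ge0. Qed.

Lemma cvar0 : cvar finset.set0 = 0%R.
Proof.
rewrite /cvar /energy; under eq_integral do rewrite /psum big_set0.
rewrite integral_cst//= probability_setT mule1.
have -> : psi finset.set0 0 = \int[P]_w (total w)%:E.
  by rewrite /psi finset.setC0; apply: eq_integral => w _; rewrite add0r.
by rewrite subee// fin_numM// (integrable_fin_num measurableT integrable_total).
Qed.

Lemma variance_total : 'V_P[eval_at X f] = (cvar [set: 'I_n]%SET)%:E.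
Proof.
have fI : \int[P]_w (total w)%:E \is a fin_num.
  apply: integrable_fin_num => //; exact: integrable_total.
rewrite eval_atE varianceE; last exact: Lfun2_total.
rewrite /cvar fineK; last by rewrite fin_numB energy_fin fin_numX.
rewrite unlock /energy; congr (_ - _); apply: eq_integral => w _.
by rewrite psiT.
Qed.

Lemma sum_cvar1_le : (\sum_(j < n) cvar [set j] <= cvar [set: 'I_n]%SET)%R.
Proof. exact: (ge0_singleton_sum m_sym m_sum m_ge0 cvar0). Qed.

Lemma mean_dimensionE : mean_dimension P X f =
  ((cvar [set: 'I_n]%SET)^-1 * \sum_(j < n) (cvar [set: 'I_n]%SET - cvar (~: [set j])))%R.
Proof.
rewrite /mean_dimension variance_total -(weighted_orthogonal_sum m_sym m_sum).
by [].
Qed.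

Lemma mean_dimension_ge1 : (0 < cvar [set: 'I_n]%SET -> 1 <= mean_dimension P X f)%R.
Proof.
move=> V0; rewrite mean_dimensionE -(weighted_orthogonal_sum m_sym m_sum).
by rewrite ler_pdivlMl// mulr1; exact: (total_le_weighted m_sym m_sum m_ge0 cvar0).
Qed.

End partial_sums.

(** * Power functions *)

Section powers.
Context {R : realType}.
Implicit Types x y a b p q s t : R.

Lemma ler_powR_neg s x y : 0 <= s -> 0 < x -> x <= y -> y `^ (- s) <= x `^ (- s).
Proof.
move=> s0 x0 xy; have y0 := lt_le_trans x0 xy.
by rewrite !powRN lef_pV2 ?posrE ?powR_gt0// ge0_ler_powR// nnegrE ltW.
Qed.

Lemma is_derive_shift_powR p y x : 0 < y + x ->
  is_derive x 1 (fun x => (y + x) `^ p) (p * (y + x) `^ (p - 1)).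
Proof.
move=> yx0.
have h1 : is_derive x 1 (fun x => y + x) 1.
  have := is_deriveD (is_derive_cst y x 1) (is_derive_id x 1).
  by rewrite add0r.
have := @is_derive1_comp _ (fun x => x `^ p) (fun x => y + x) x _ _ (is_derive1_powR p yx0) h1.
by rewrite mulr1.
Qed.

(** At the intermediate point t of the mean value theorem the ratio of derivatives is ((y + t) / (1
    + t))^(p - 1), the factor p cancelling. This base is a weighted mean of y and 1, hence lies
    between them, and the exponent is negative. *)
Let ratio_lt p y a b : p != 0 -> p < 1 -> 0 < y -> 0 <= a -> a < b ->
  exists c, [/\ Num.min 1 (y `^ (- (1 - p))) <= c,
    c <= Num.max 1 (y `^ (- (1 - p))) &
    (y + a) `^ p - (y + b) `^ p = c * ((1 + a) `^ p - (1 + b) `^ p)].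
Proof.
move=> p0 p1 y0 a0 ab.
have s0 : 0 <= 1 - p by lra.
have dy z x : 0 < z -> a <= x -> is_derive x 1 (fun x => (z + x) `^ p) (p * (z + x) `^ (p - 1)).
  by move=> z0 ax; apply: is_derive_shift_powR; lra.
have cy z : 0 < z -> {within `[a, b], continuous (fun x => (z + x) `^ p)}.
  move=> z0; apply: derivable_within_continuous => x; rewrite in_itv/= => /andP[ax _].
  by have := dy z x z0 ax; case.
have dI z x : 0 < z -> x \in `]a, b[ ->
    is_derive x 1 (fun x => (z + x) `^ p) (p * (z + x) `^ (p - 1)).
  by move=> z0; rewrite in_itv/= => /andP[ax _]; apply: dy => //; exact: ltW.
have dg0 x : x \in `]a, b[ -> p * (1 + x) `^ (p - 1) != 0.
  rewrite in_itv/= => /andP[ax _].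
  by rewrite mulf_neq0// gt_eqF// powR_gt0//; lra.
have [c] := cauchy_MVT ab (cy _ y0) (cy _ ltr01) (fun x => dI y x y0)
  (fun x => dI 1 x ltr01) dg0.
rewrite in_itv/= => /andP[ac _].
have c1 : 0 < 1 + c by lra.
have yc : 0 < y + c by lra.
rewrite -mulf_div divff// mul1r.
have -> : (y + c) `^ (p - 1) / (1 + c) `^ (p - 1) = ((y + c) / (1 + c)) `^ (- (1 - p)).
  rewrite opprB powRM ?ltW ?invr_gt0// -(powR_inv1 (ltW c1)) -powRrM mulN1r.
  by rewrite powRN.
set r := (y + c) / (1 + c) => E.
have r0 : 0 < r by exact: divr_gt0.
have one : 1 `^ (- (1 - p)) = 1 :> R by rewrite powR1.
exists (r `^ (- (1 - p))); split.
- rewrite ge_min; apply/orP; have [y1|y1] := leP y 1.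
    left; rewrite -[leLHS]one ler_powR_neg//.
    by rewrite /r ler_pdivrMr//; lra.
  right; rewrite ler_powR_neg// /r ler_pdivrMr//.
  by rewrite mulrDr mulr1 lerD2l ler_peMl//; lra.
- rewrite le_max; apply/orP; have [y1|y1] := leP y 1.
    right; rewrite ler_powR_neg// /r ler_pdivlMr//.
    by rewrite mulrDr mulr1 lerD2l ler_piMl//; lra.
  left; rewrite -[leRHS]one ler_powR_neg//.
  by rewrite /r ler_pdivlMr//; lra.
- (* Otherwise the quotient [E] would be 0, by the convention [x / 0 = 0]. *)
  have nz : (1 + b) `^ p - (1 + a) `^ p != 0.
    apply/eqP => nz; move: E; rewrite nz invr0 mulr0 => /eqP.
    by rewrite gt_eqF// powR_gt0.
  have : (y + b) `^ p - (y + a) `^ p =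
      r `^ (- (1 - p)) * ((1 + b) `^ p - (1 + a) `^ p) by rewrite E divfK.
  by lra.
Qed.

Lemma powR_increment_ratio p y a b : p != 0 -> p < 1 -> 0 < y -> 0 <= a -> 0 <= b ->
  exists c, [/\ Num.min 1 (y `^ (- (1 - p))) <= c,
    c <= Num.max 1 (y `^ (- (1 - p))) &
    (y + a) `^ p - (y + b) `^ p = c * ((1 + a) `^ p - (1 + b) `^ p)].
Proof.
move=> p0 p1 y0 a0 b0; have [ab|ba|<-] := ltgtP a b.
- exact: ratio_lt.
- have [c [c1 c2 E]] := ratio_lt p0 p1 y0 b0 ba; exists c; split => //.
  by rewrite -opprB E -mulrN opprB.
- exists 1; split; last by rewrite !subrr mulr0.
    by rewrite ge_min lexx.
  by rewrite le_max lexx.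
Qed.

(** A pointwise Chebyshev truncation at [y0], where y0^(-q) = 1 + e. Above [y0] the bound is 1 + e;
    below it, the power k = y^(-q) is at most e k^2 + 1 / e, and the quadratic term exceeds 1 / e.
    After integration, the squared power costs only e times a bounded moment. *)
Lemma max1_powR_le q e : 0 < q -> 0 < e -> exists2 C, 0 <= C &
  forall y, 0 < y -> Num.max 1 (y `^ (- q)) <=
    1 + e + e * y `^ (- (q * 2)) + C * (y - 1) ^+ 2.
Proof.
move=> q0 e0; pose y0 := (1 + e) `^ (- q^-1).
have e1 : 0 < 1 + e by lra.
have y00 : 0 < y0 by exact: powR_gt0.
have y0q : y0 `^ (- q) = 1 + e.
  by rewrite /y0 -powRrM mulrNN mulVf ?gt_eqF// powRr1// ltW.
have y01 : y0 < 1.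
  rewrite ltNge; apply/negP => y1.
  have := ler_powR_neg (ltW q0) ltr01 y1.
  by rewrite y0q powR1; lra.
exists ((1 - y0) ^- 2 / e) => [|y y_gt0].
  by rewrite divr_ge0 ?invr_ge0 ?sqr_ge0// ltW.
have p2 : y `^ (- (q * 2)) = (y `^ (- q)) ^+ 2.
  by rewrite -mulNr powRrM powR_mulrn// powR_ge0.
rewrite p2; have := powR_ge0 y (- q); set k := y `^ (- q) => k0.
have C0 : 0 <= (1 - y0) ^- 2 / e * (y - 1) ^+ 2.
  by rewrite mulr_ge0 ?sqr_ge0// divr_ge0 ?invr_ge0 ?sqr_ge0// ltW.
have ek : 0 <= e * k ^+ 2 by rewrite mulr_ge0 ?sqr_ge0// ltW.
rewrite ge_max; apply/andP; split; first lra.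
have [yy0|yy0] := leP y0 y.
  have : k <= 1 + e by rewrite -y0q; apply: ler_powR_neg => //; exact: ltW.
  by lra.
have C1 : e^-1 <= (1 - y0) ^- 2 / e * (y - 1) ^+ 2.
  rewrite mulrAC -[leLHS]mul1r ler_pM2r ?invr_gt0//.
  rewrite mulrC ler_pdivlMr ?exprn_gt0 ?subr_gt0// mul1r -[leRHS]sqrrN opprB.
  by rewrite lerXn2r ?nnegrE; lra.
have : k <= e * k ^+ 2 + e^-1.
  (* Completing the square: e k^2 + 1 / e - k = ((e k - 1/2)^2 + 3/4) / e. *)
  have h : 0 <= e^-1 * ((e * k - 2^-1) ^+ 2 + 3%:R / 4%:R).
    apply: mulr_ge0; first by rewrite invr_ge0 ltW.
    by apply: addr_ge0; [exact: sqr_ge0|lra].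
  suff -> : e * k ^+ 2 + e^-1 = k + e^-1 * ((e * k - 2^-1) ^+ 2 + 3%:R / 4%:R).
    by rewrite lerDl.
  by field; rewrite gt_eqF.
by lra.
Qed.

Lemma max1_powR_sqr y s :
  Num.max 1 (y `^ (- (s * 2))) = Num.max 1 (y `^ (- s)) ^+ 2.
Proof.
have -> : y `^ (- (s * 2)) = (y `^ (- s)) ^+ 2.
  by rewrite -mulNr powRrM powR_mulrn// powR_ge0.
have := powR_ge0 y (- s); set t := y `^ _ => t0.
have [t1|t1] := leP t 1; first by rewrite !max_l// ?expr1n// exprn_ile1.
by rewrite !max_r// ?exprn_ege1// ltW.
Qed.

(** Truncation at [y0], where y0^(-r) = 1 - e: up to [y0] the power is at least 1 - e, and beyond it
    the quadratic term exceeds 1, so the left side is negative. *)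
Lemma min1_powR_ge r e : 0 < r -> 0 < e -> e < 1 -> exists2 C, 0 <= C &
  forall y, 0 < y -> 1 - e - C * (y - 1) ^+ 2 <= Num.min 1 (y `^ (- r)).
Proof.
move=> r0 e0 e1; pose y0 := (1 - e) `^ (- r^-1).
have e1' : 0 < 1 - e by lra.
have y00 : 0 < y0 by exact: powR_gt0.
have y0r : y0 `^ (- r) = 1 - e.
  by rewrite /y0 -powRrM mulrNN mulVf ?gt_eqF// powRr1// ltW.
have y01 : 1 < y0.
  rewrite ltNge; apply/negP => y1.
  have := ler_powR_neg (ltW r0) y00 y1.
  by rewrite y0r powR1; lra.
exists ((y0 - 1) ^- 2) => [|y y_gt0]; first by rewrite invr_ge0 sqr_ge0.
have C0 : 0 <= (y0 - 1) ^- 2 * (y - 1) ^+ 2.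
  by rewrite mulr_ge0 ?sqr_ge0// invr_ge0 ?sqr_ge0.
rewrite le_min; apply/andP; split; first lra.
have [yy0|yy0] := leP y y0.
  have : 1 - e <= y `^ (- r) by rewrite -y0r; apply: ler_powR_neg => //; exact: ltW.
  by lra.
have C1 : 1 <= (y0 - 1) ^- 2 * (y - 1) ^+ 2.
  rewrite mulrC ler_pdivlMr ?exprn_gt0 ?subr_gt0// mul1r.
  by rewrite lerXn2r ?nnegrE; lra.
by have := powR_ge0 y (- r); lra.
Qed.

(** Tangent line of the concave power at 1. With w = x^t and u = ln x, the bound exp s >= 1 + s
    gives w (1 + (1 - t) u) <= x and w (1 - t u) <= 1; weights t and 1 - t make u cancel. *)
Lemma powR_le_affine t x : 0 <= t -> t <= 1 -> 0 < x -> x `^ t <= 1 - t + t * x.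
Proof.
move=> t0 t1 x0; pose w := x `^ t.
have w0 : 0 < w by exact: powR_gt0.
rewrite -/w; set u := ln x.
have wE : w = expR (t * u) by rewrite /w /powR gt_eqF.
have h1 : w * (1 + (1 - t) * u) <= x.
  rewrite -[leRHS](lnK x0) -/u.
  have -> : expR u = w * expR ((1 - t) * u) by rewrite wE -expRD; congr expR; ring.
  by rewrite ler_pM2l// expR_ge1Dx.
have h2 : w * (1 - t * u) <= 1.
  rewrite [leRHS](_ : 1 = w * expR (- (t * u))); last by rewrite wE -expRD subrr expR0.
  by rewrite ler_pM2l// expR_ge1Dx.
have h3 : (1 - t) * (w * (1 - t * u)) <= (1 - t) * 1 by apply: ler_wpM2l => //; lra.
have h4 : t * (w * (1 + (1 - t) * u)) <= t * x by exact: ler_wpM2l.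
by lra.
Qed.

Lemma powR_prod (I : finType) (A : {pred I}) (x : I -> R) t :
  (forall i, i \in A -> 0 <= x i) ->
  (\prod_(i in A) x i) `^ t = \prod_(i in A) x i `^ t.
Proof.
move=> x0.
suff [] : 0 <= \prod_(i in A) x i /\ (\prod_(i in A) x i) `^ t = \prod_(i in A) x i `^ t by [].
elim/big_rec2 : _ => [|i u v iA [v0 IH]]; first by rewrite powR1.
by rewrite powRM ?x0// IH; split => //; rewrite mulr_ge0// x0.
Qed.

(** AM-GM raised to a negative power: the order s is shared equally among the factors. *)
Lemma mean_powR_le_prod (I : finType) (A : {pred I}) (x : I -> R) s :
  (0 < #|A|)%N -> 0 <= s -> (forall i, i \in A -> 0 < x i) ->
  ((\sum_(i in A) x i) / #|A|%:R) `^ (- s) <=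
  \prod_(i in A) x i `^ (- (s / #|A|%:R)).
Proof.
move=> A0 s0 x0; set k := #|A|; set y := _ / _.
have k0 : 0 < k%:R :> R by rewrite ltr0n.
have y0 : 0 < y.
  have [i iA] := card_gt0P A0.
  rewrite divr_gt0// (bigD1 i)//= ltr_pwDl ?x0// sumr_ge0// => j /andP[jA _].
  by rewrite ltW// x0.
rewrite -powR_prod => [|i iA]; last by rewrite ltW// x0.
have -> : y `^ (- s) = (y ^+ k) `^ (- (s / k%:R)).
  rewrite -powR_mulrn ?ltW// -powRrM; congr (_ `^ _).
  by rewrite mulrN mulrC divfK// gt_eqF.
apply: ler_powR_neg.
- by rewrite divr_ge0// ltW.
- by rewrite prodr_gt0.
- have := leif_AGM (A := A) (E := x); rewrite /= => h.
  by have [] := h (fun i iA => ltW (x0 i iA)).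
Qed.

End powers.

(** * Leave-one-out comparison *)

Lemma fine_sub_le (R : realType) (a b c : \bar R) (r : R) :
  (a \is a fin_num -> b \is a fin_num -> c \is a fin_num ->
  a <= b + r%:E -> (fine (a - c) - fine (b - c) <= r)%R)%E.
Proof.
case: a b c => [a||] [b||] [c||]//= _ _ _; rewrite lee_fin => ab; lra.
Qed.

Section power_mean.
Context {disp : measure_display} {T : measurableType disp} {R : realType}.
Variables (P : probability T R) (n : nat) (X : 'I_n -> T -> R) (m p : R).
Hypothesis mX : forall j, measurable_fun setT (X j).
Hypothesis indep : finitely_independent P X.
Hypothesis X_gt0 : forall j, {ae P, forall w, (0 < X j w)%R}.
Hypothesis X2 : forall j, X j \in Lfun P 2%:E.
Hypotheses (m_gt0 : 0 < m) (p_neq0 : p != 0) (p_lt1 : p < 1) (n_ge2 : (1 < n)%N).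
Local Open Scope ereal_scope.

Lemma psum_gt0 (u : {set 'I_n}) : u != finset.set0 ->
  {ae P, forall w, (0 < psum X u w)%R}.
Proof.
move=> /set0Pn[i iu].
have : {ae P, forall w, forall j, (0 < X j w)%R} by exact: filter_forall.
apply: filterS => w Xw; rewrite /psum (bigD1 i)//= ltr_pwDl ?Xw// sumr_ge0// => j _.
exact: ltW.
Qed.

Lemma setC1_neq0 (j : 'I_n) : ~: [set j] != finset.set0 :> {set 'I_n}.
Proof. by rewrite -card_gt0 cardsC1 card_ord -ltnS prednK// ltnW. Qed.

Definition pow_mean (s : R) : R := ((s / m) `^ p)%R.

Local Notation h := pow_mean.
Local Notation full := [set: 'I_n]%SET.

Lemma measurable_pow_mean : measurable_fun setT h.
Proof.
apply: (measurableT_comp (measurable_powR _)); exact: measurable_funM.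
Qed.

Lemma pow_mean_ge0 s : (0 <= h s)%R. Proof. exact: powR_ge0. Qed.

Let mh := measurable_pow_mean.
Let h0 := pow_mean_ge0.

Definition marginal j (w : T) : R := ((1 + X j w / m) `^ p)%R.
Definition leave_one_out j (w : T) : R := (psum X (~: [set j]) w / m)%R.

Lemma measurable_rest j : measurable_fun setT (leave_one_out j).
Proof. by apply: measurable_funM => //; exact: measurable_psumT. Qed.

Lemma rest_gt0 j : {ae P, forall w, (0 < leave_one_out j w)%R}.
Proof.
by apply: filterS (psum_gt0 (setC1_neq0 j)) => w sw; rewrite divr_gt0.
Qed.

Lemma psum1 j w : psum X [set j] w = X j w.
Proof. by rewrite /psum big_set1. Qed.

(** The base 1 + X / m is at least 1 and p < 1, so the power is at most its base, for negative p
    too. *)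
Lemma Lfun2_marginal j : marginal j \in Lfun P 2%:E.
Proof.
have mm : measurable_fun setT (marginal j).
  apply: (measurableT_comp (measurable_powR _)); apply: measurable_funD => //.
  exact: measurable_funM.
have X1 : (fun w => 1 + X j w / m)%R \in Lfun P 2%:E.
  have -> : (fun w => 1 + X j w / m)%R = (cst 1 + m^-1 \o* X j)%R.
    by [].
  rewrite rpredD ?lee1n//= => _; [exact: Lfun_cst|by apply: Lfun_scale => //; rewrite ler1n].
apply: (Lfun2P mm); apply: le_lt_trans (Lfun2_lty X1).
apply: ae_ge0_le_integral => //.
- by move=> w _; rewrite lee_fin sqr_ge0.
- by apply/measurable_EFinP; exact: measurable_funX.
- by move=> w _; rewrite lee_fin sqr_ge0.
- apply/measurable_EFinP; apply: measurable_funX; exact: Lfun2_measurable X1.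
apply: filterS (X_gt0 j) => w Xw _; rewrite lee_fin.
have x0 : (0 <= X j w / m)%R by rewrite divr_ge0 ?ltW.
apply: lerXn2r; rewrite ?nnegrE ?powR_ge0 ?addr_ge0//.
by apply: ler1_powR; [rewrite lerDl|exact: ltW].
Qed.

Let increment s a b : (0 < s)%R -> (0 <= a)%R -> (0 <= b)%R -> exists c : R,
  [/\ Num.min 1 ((s / m) `^ (- (1 - p))) <= c,
    c <= Num.max 1 ((s / m) `^ (- (1 - p))) &
    h (s + a) - h (s + b) = c * ((1 + a / m) `^ p - (1 + b / m) `^ p)]%R.
Proof.
move=> s0 a0 b0; rewrite /h !mulrDl.
by apply: powR_increment_ratio => //; rewrite ?divr_gt0 ?divr_ge0// ltW.
Qed.

Lemma variance_shift_le s j : (0 < s)%R ->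
  (fun w => h (s + X j w)) \in Lfun P 2%:E ->
  (fine 'V_P[fun w => h (s + X j w)] <=
   Num.max 1 ((s / m) `^ (- ((1 - p) * 2))) * fine 'V_P[marginal j])%R.
Proof.
move=> s0 Z2; rewrite max1_powR_sqr.
apply: variance_lipschitz Z2 (Lfun2_marginal j) _.
apply: filterS (X_gt0 j) => w1 X1; apply: filterS (X_gt0 j) => w2 X2'.
have [c [c1 c2 E]] := increment s0 (ltW X1) (ltW X2').
have c0 : (0 <= c)%R by apply: le_trans c1; rewrite le_min ler01 powR_ge0.
by rewrite E normrM (ger0_norm c0); apply: ler_wpM2r.
Qed.

Lemma variance_marginal_gt0 j : (0 < fine 'V_P[X j])%R ->
  (0 < fine 'V_P[marginal j])%R.
Proof.
move=> VX; rewrite lt_neqAle fine_ge0 ?variance_ge0// andbT eq_sym.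
apply/eqP => V0; have [a aE] := variance0_ae (Lfun2_marginal j) V0.
(* A constant marginal could be inverted, since p is nonzero: [X j] would be almost surely constant,
   against its positive variance. *)
move: VX; rewrite (@variance_ae_cst _ _ _ P (X j) (m * (a `^ p^-1 - 1))%R) ?ltxx//.
apply: filterS2 (X_gt0 j) aE => w Xw <-.
rewrite /marginal -powRrM divff// powRr1; last by rewrite addr_ge0// divr_ge0 ?ltW.
by rewrite addrAC subrr add0r mulrC divfK// gt_eqF.
Qed.

(** Averages the increment identity over the other variables. The sign condition lets the ratio be
    replaced by its lower bound, and the additive form admits infinite values of [psi]. *)
Lemma psi1_increment_ge j (b x x' : R) :
  b%:E <= \int[P]_w (Num.min 1 (leave_one_out j w `^ (- (1 - p))))%:E ->
  (0 < x)%R -> (0 < x')%R -> (0 <= (1 + x / m) `^ p - (1 + x' / m) `^ p)%R ->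
  (b * ((1 + x / m) `^ p - (1 + x' / m) `^ p))%:E + psi P X h [set j] x' <=
  psi P X h [set j] x.
Proof.
move=> Hb x0 x'0; set D := (_ - _)%R => D0; rewrite /psi.
pose k w := Num.min 1%R (leave_one_out j w `^ (- (1 - p)))%R.
have k0 w : (0 <= k w)%R by rewrite /k le_min ler01 powR_ge0.
have mk : measurable_fun setT k.
  apply: measurable_minr; first exact: measurable_cst.
  apply: (measurableT_comp (measurable_powR _)); exact: measurable_rest.
have mDk : measurable_fun setT (fun w => (D * k w)%:E).
  by apply/measurable_EFinP; exact: measurable_funM.
have Dk0 w : 0 <= (D * k w)%:E by rewrite lee_fin mulr_ge0.
have mh' x1 : measurable_fun setT (fun w0 => (h (x1 + psum X (~: [set j]) w0))%:E).
  apply/measurable_EFinP; apply: measurableT_comp mh _; apply: measurable_funD.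
    exact: measurable_cst.
  exact: measurable_psumT.
have h0' x1 w0 : 0 <= (h (x1 + psum X (~: [set j]) w0))%:E by rewrite lee_fin.
apply: (@le_trans _ _ (\int[P]_w0 ((D * k w0)%:E + (h (x' + psum X (~: [set j]) w0))%:E))).
  rewrite (ge0_integralD _ measurableT (fun w _ => Dk0 w) mDk (fun w _ => h0' _ w) (mh' _)).
  apply: leeD; last exact: lexx.
  under eq_integral do rewrite EFinM.
  have mkE : measurable_fun setT (fun w => (k w)%:E) by exact/measurable_EFinP.
  rewrite (ge0_integralZl _ measurableT mkE); last 2 first.
  - by move=> w _; rewrite lee_fin.
  - by rewrite lee_fin.
  by rewrite mulrC EFinM; apply: lee_wpmul2l Hb; rewrite lee_fin.
apply: (ae_ge0_le_integral measurableT) (fun w _ => h0' _ w) (mh' _) _.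
- by move=> w0 _; rewrite adde_ge0.
- exact: emeasurable_funD mDk (mh' _).
apply: filterS (psum_gt0 (setC1_neq0 j)) => w0 s0 _; rewrite -EFinD lee_fin.
have [c [c1 _ E]] := increment s0 (ltW x0) (ltW x'0).
have : (D * k w0 <= c * D)%R by rewrite mulrC ler_wpM2r.
move: E; rewrite -/D ![(_ + psum _ _ _)%R]addrC; lra.
Qed.

Hypothesis total2 : \int[P]_w (total X h w ^+ 2)%:E < +oo.

(** With the other variables frozen, the second moment in [X j] is the squared mean plus a variance,
    and [variance_shift_le] bounds the latter. *)
Lemma integral_sqr_shift_le j : {ae P, forall w,
  \int[P]_w' (h (psum X (~: [set j]) w + X j w') ^+ 2)%:E <=
  psi P X h (~: [set j]) (psum X (~: [set j]) w) ^+ 2 +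
  (Num.max 1 (leave_one_out j w `^ (- ((1 - p) * 2))) * fine 'V_P[marginal j])%:E}.
Proof.
set u := ~: [set j]; have uC : ~: u = [set j]%SET by rewrite /u finset.setCK.
pose Phi s : \bar R := (h s ^+ 2)%:E.
have mPhi : measurable_fun setT Phi.
  by apply/measurable_EFinP; exact: measurable_funX.
have Phi0 s : 0 <= Phi s by rewrite lee_fin sqr_ge0.
pose I w := \int[P]_w' Phi (psum X u w + psum X (~: u) w')%R.
have E1 : energy P X h full = \int[P]_w I w.
  rewrite /I -(integral_psumT mX indep u mPhi Phi0); apply: eq_integral => w _.
  by rewrite psiT /Phi -EFin_expe.
have mI : measurable_fun setT I.
  exact: (measurableT_comp (measurable_shift P mX (~: u) mPhi Phi0) (@measurable_psumT _ _ _ _ _ mX u)).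
have I0 w : 0 <= I w by exact: integral_ge0.
have Iint : P.-integrable setT I.
  apply/integrableP; split; first exact: mI.
  under eq_integral do rewrite (gee0_abs (I0 _)).
  by rewrite -E1; exact: (energy_lty mX indep mh h0 total2).
(* The section [Z] is square integrable where [I w] is finite; this holds almost surely, since [I]
   integrates to the finite second moment of the total. *)
apply: filterS2 (psum_gt0 (setC1_neq0 j)) (integrable_ae measurableT Iint) => w sw /(_ Logic.I) Iw.
pose Z w' := h (psum X u w + X j w')%R.
have mZ : measurable_fun setT Z.
  by apply: measurableT_comp mh _; exact: measurable_funD.
have IZ : I w = \int[P]_w' (Z w' ^+ 2)%:E.
  by apply: eq_integral => w' _; rewrite /Phi uC psum1.
have Z2 : Z \in Lfun P 2%:E by apply: (Lfun2P mZ); rewrite -IZ ltey_eq Iw.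
have pZ : psi P X h u (psum X u w) = \int[P]_w' (Z w')%:E.
  by apply: eq_integral => w' _; rewrite uC psum1.
have VZ : 'V_P[Z] = \int[P]_w' (Z w' ^+ 2)%:E - (\int[P]_w' (Z w')%:E) ^+ 2.
  by rewrite (varianceE Z2) !expectationE.
have := variance_shift_le sw Z2; rewrite -lee_fin -(variance_fine Z2) VZ.
rewrite leeBlDr; last by apply: fin_numX; rewrite (Lfun2_Lfun1_fine Z2).
by rewrite pZ addeC.
Qed.

(** The left side is the total effect E(Var(f | all but j)): the squared means cancel, and the two
    energies are compared by integrating [integral_sqr_shift_le] over the other variables. *)
Lemma cvar_drop_le j (A : R) :
  \int[P]_w (Num.max 1 (leave_one_out j w `^ (- ((1 - p) * 2))))%:E <= A%:E ->
  (cvar P X h full - cvar P X h (~: [set j]) <= A * fine 'V_P[marginal j])%R.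
Proof.
move=> HA; set v := fine 'V_P[marginal j].
have v0 : (0 <= v)%R by rewrite fine_ge0 ?variance_ge0.
pose Phi s : \bar R := (h s ^+ 2)%:E.
have mPhi : measurable_fun setT Phi.
  by apply/measurable_EFinP; exact: measurable_funX.
have Phi0 s : 0 <= Phi s by rewrite lee_fin sqr_ge0.
pose u := ~: [set j]; have uC : ~: u = [set j]%SET by rewrite /u finset.setCK.
pose I w := \int[P]_w' Phi (psum X u w + psum X (~: u) w')%R.
have mI : measurable_fun setT I.
  exact: (measurableT_comp (measurable_shift P mX (~: u) mPhi Phi0) (@measurable_psumT _ _ _ _ _ mX u)).
have I0 w : 0 <= I w by exact: integral_ge0.
have E1 : energy P X h full = \int[P]_w I w.
  rewrite /I -(integral_psumT mX indep u mPhi Phi0); apply: eq_integral => w _.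
  by rewrite psiT /Phi -EFin_expe.
pose k w := Num.max 1%R (leave_one_out j w `^ (- ((1 - p) * 2)))%R.
have k0 w : (0 <= k w)%R by rewrite /k le_max ler01.
have kv0 w : (0 <= k w * v)%R by exact: mulr_ge0.
have mk : measurable_fun setT k.
  apply: measurable_maxr; first exact: measurable_cst.
  apply: (measurableT_comp (measurable_powR _)); exact: measurable_rest.
have mkv : measurable_fun setT (fun w => (k w * v)%:E).
  by apply/measurable_EFinP; exact: measurable_funM.
pose p2 w := psi P X h u (psum X u w) ^+ 2.
have p20 w : 0 <= p2 w by exact: sqre_ge0.
have mpsi : measurable_fun setT p2.
  have m1 := measurable_from_sigma mX (@measurable_psi_psum _ _ _ P _ _ mX _ mh h0 u).
  exact: (emeasurable_funM m1 m1).
have E2 : energy P X h full <= energy P X h u + (A * v)%:E.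
  rewrite E1; apply: (@le_trans _ _ (\int[P]_w (p2 w + (k w * v)%:E))).
    apply: (ae_ge0_le_integral measurableT (fun w _ => I0 w) mI).
    - by move=> w _; rewrite adde_ge0 ?p20 ?lee_fin ?kv0.
    - exact: emeasurable_funD mpsi mkv.
    - apply: filterS (integral_sqr_shift_le j) => w Hw _.
      by rewrite /I uC; under eq_integral do rewrite psum1.
  rewrite (ge0_integralD _ measurableT (fun w _ => p20 w) mpsi _ mkv); last first.
    by move=> w _; rewrite lee_fin kv0.
  apply: leeD; first exact: lexx.
  under eq_integral do rewrite mulrC EFinM.
  have mkE : measurable_fun setT (fun w => (k w)%:E) by exact/measurable_EFinP.
  rewrite (ge0_integralZl _ measurableT mkE); last 2 first.
  - by move=> w _; rewrite lee_fin.
  - by rewrite lee_fin.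
  by rewrite mulrC EFinM; apply: lee_wpmul2l HA; rewrite lee_fin.
have ef w := energy_fin mX indep mh h0 total2 w.
have mf : (\int[P]_w (total X h w)%:E) ^+ 2 \is a fin_num.
  by apply: fin_numX; rewrite (Lfun2_Lfun1_fine (Lfun2_total mX mh total2)).
exact: fine_sub_le (ef full) (ef u) mf E2.
Qed.

(** The Lipschitz comparison is read backwards: [marginal j] varies at most 1 / b times as much as
    the conditional expectation given [X j]. *)
Lemma cvar1_ge j (b : R) : (0 < b)%R ->
  b%:E <= \int[P]_w (Num.min 1 (leave_one_out j w `^ (- (1 - p))))%:E ->
  (b ^+ 2 * fine 'V_P[marginal j] <= cvar P X h [set j])%R.
Proof.
move=> b0 Hb.
have c2 := Lfun2_cexp mX indep mh h0 total2 [set j].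
have := covariance_cexp mX indep mh h0 total2 [set j] [set j].
rewrite finset.setIid => <-.
pose G w := (0 < X j w)%R /\ psi P X h [set j] (X j w) = (cexp P X h [set j] w)%:E.
have Gae : {ae P, forall w, G w}.
  apply: filterS2 (X_gt0 j) (cexpE mX indep mh h0 total2 [set j]) => w X0 cw.
  by split; [exact: X0|rewrite -cw psum1].
have step x x' a a' : (0 < x)%R -> (0 < x')%R -> psi P X h [set j] x = a%:E ->
    psi P X h [set j] x' = a'%:E -> ((1 + x' / m) `^ p <= (1 + x / m) `^ p)%R ->
    (b * ((1 + x / m) `^ p - (1 + x' / m) `^ p) <= `|a - a'|)%R.
  move=> x0 x'0 xa xa'; rewrite -subr_ge0 => D0.
  have := psi1_increment_ge Hb x0 x'0 D0; rewrite xa xa' -EFinD lee_fin -lerBrDr.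
  by move=> /le_trans; apply; exact: ler_norm.
suff : (fine 'V_P[marginal j] <= b^-1 ^+ 2 * fine 'V_P[cexp P X h [set j]])%R.
  by rewrite exprVn ler_pdivlMl ?exprn_gt0.
apply: variance_lipschitz (Lfun2_marginal j) c2 _.
apply: (filterS _ Gae) => w [X1 a1]; apply: (filterS _ Gae) => w' [X2' a2].
rewrite mulrC ler_pdivlMr; last exact: b0.
(* The increment bound requires a nonnegative difference, so the two copies are ordered first. *)
rewrite mulrC; have [le|/ltW le] := leP (marginal j w') (marginal j w).
  by rewrite ger0_norm ?subr_ge0; [exact: step X1 X2' a1 a2 le|exact: le].
rewrite distrC ger0_norm ?subr_ge0; last exact: le.
by rewrite [leRHS]distrC; exact: step X2' X1 a2 a1 le.
Qed.

End power_mean.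

(** * Moment bounds *)

Section moments.
Context {disp : measure_display} {T : measurableType disp} {R : realType}.
Variables (P : probability T R) (n : nat) (X : 'I_n -> T -> R).
Hypothesis mX : forall j, measurable_fun setT (X j).
Hypothesis indep : finitely_independent P X.
Hypothesis X_gt0 : forall j, {ae P, forall w, (0 < X j w)%R}.
Implicit Types u A : {set 'I_n}.
Local Open Scope ereal_scope.

(** This is [decouple_sum] with zero shift and the block reduced to [j]. *)
Lemma integral_mul_indep (u : {set 'I_n}) j (H : sigma_type X u -> R) (g : R -> R) :
  j \notin u -> measurable_fun setT H -> (forall w, 0 <= H w)%R ->
  measurable_fun setT g -> (forall s, 0 <= g s)%R ->
  \int[P]_w (H w * g (X j w))%:E = (\int[P]_w (H w)%:E) * \int[P]_w (g (X j w))%:E.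
Proof.
move=> ju mH H0 mg g0.
have uj : u \subset ~: [set j].
  by rewrite finset.subsetC finset.sub1set inE.
have mHE : measurable_fun setT (fun w : sigma_type X u => (H w)%:E).
  exact/measurable_EFinP.
have mHT : measurable_fun setT (fun w : T => (H w)%:E) by exact: (measurable_from_sigma mX mHE).
have mgE : measurable_fun setT (fun s => (g s)%:E) by exact/measurable_EFinP.
have gE0 s : 0 <= (g s)%:E by rewrite lee_fin.
have HE0 w : 0 <= (H w)%:E by rewrite lee_fin.
have m0 : measurable_fun setT (cst 0%R : sigma_type X u -> R) by exact: measurable_cst.
have := decouple_sum mX indep uj mHE HE0 m0 mgE gE0.
under eq_integral do rewrite add0r psum1 -EFinM.
move=> ->; under eq_integral => w _.
  under eq_integral do rewrite add0r psum1.
  rewrite muleC.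
  over.
rewrite (ge0_integralZl _ measurableT mHT); first by rewrite muleC.
- by move=> w _; exact: HE0.
- by apply: integral_ge0 => w _; exact: gE0.
Qed.

Lemma measurable_coord_prod u (g : R -> R) : measurable_fun setT g ->
  measurable_fun setT
    (fun w : sigma_type X u => (\prod_(i in u) g (X i w))%R).
Proof.
move=> mg.
rewrite (_ : (fun w : sigma_type X u => _) =
  fun w => (\prod_(i <- index_enum 'I_n) if i \in u then g (X i w) else 1)%R); last first.
  by apply/funext => w; rewrite big_mkcond.
apply: measurable_prod => j _.
case: (boolP (j \in u)) => // ju.
by apply: measurableT_comp => //; exact: measurable_coord.
Qed.

Lemma integral_prod_le A (g : R -> R) (c : R) : measurable_fun setT g ->
  (forall s, 0 <= g s)%R -> (0 <= c)%R ->
  (forall j, j \in A -> \int[P]_w (g (X j w))%:E <= c%:E) ->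
  \int[P]_w (\prod_(i in A) g (X i w))%:E <= (c ^+ #|A|)%:E.
Proof.
move=> mg g0 c0; have [k] := ubnP #|A|; elim: k A => // k IH A; rewrite ltnS => Ak Hc.
have [->|/set0Pn[j jA]] := eqVneq A finset.set0.
  under eq_integral do rewrite big_set0.
  by rewrite integral_cst//= probability_setT mule1 cards0 expr0.
have jD : j \notin A :\ j by rewrite !inE eqxx.
under eq_integral do rewrite (big_setD1 j jA)/= mulrC.
have H0 w : (0 <= \prod_(i in A :\ j) g (X i w))%R by apply: prodr_ge0.
rewrite (integral_mul_indep jD (measurable_coord_prod mg) H0 mg g0).
rewrite (cardsD1 j A) jA exprS mulrC EFinM; apply: lee_pmul.
- by apply: integral_ge0 => w _; rewrite lee_fin.
- by apply: integral_ge0 => w _; rewrite lee_fin.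
- apply: IH.
    by rewrite (cardsD1 j A) jA in Ak.
  by move=> i; rewrite !inE => /andP[_]; exact: Hc.
- exact: Hc.
Qed.

Section negative_moments.
Variables (alpha M : R).
Hypotheses (alpha_gt0 : (0 < alpha)%R) (M_gt0 : (0 < M)%R).
Hypothesis X_neg_moment : forall j, \int[P]_w (X j w `^ (- alpha))%:E <= M%:E.

Lemma measurable_powRl (g : T -> R) (t : R) : measurable_fun setT g ->
  measurable_fun setT (fun w => (g w `^ t)%R).
Proof. by move=> mg; exact: (measurableT_comp (measurable_powR _) mg). Qed.

(** Lyapunov's inequality: for r = t / alpha and v = X^(-alpha) / M one has X^(-t) = M^r v^r <= M^r
    (1 - r + r v), and v has mean at most 1. *)
Lemma lower_neg_moment j t : (0 <= t <= alpha)%R ->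
  \int[P]_w (X j w `^ (- t))%:E <= (M `^ (t / alpha))%:E.
Proof.
move=> /andP[t0 ta]; set r := (t / alpha)%R.
have r0 : (0 <= r)%R by rewrite divr_ge0// ltW.
have r1 : (r <= 1)%R by rewrite ler_pdivrMr// mul1r.
have Mr0 : (0 <= M `^ r)%R by exact: powR_ge0.
have ma : measurable_fun setT (fun w => (X j w `^ (- alpha))%:E).
  by apply/measurable_EFinP; exact: measurable_powRl.
have c0 : (0 <= M `^ r * (r / M))%R by rewrite mulr_ge0// divr_ge0// ltW.
have d0 : (0 <= M `^ r * (1 - r))%R by rewrite mulr_ge0// subr_ge0.
apply: (@le_trans _ _ (\int[P]_w ((M `^ r * (1 - r))%:E +
    (M `^ r * (r / M))%:E * (X j w `^ (- alpha))%:E))).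
  apply: ae_ge0_le_integral => //.
  - by move=> w _; rewrite lee_fin powR_ge0.
  - by apply/measurable_EFinP; exact: measurable_powRl.
  - by move=> w _; rewrite -EFinM -EFinD lee_fin addr_ge0// mulr_ge0// powR_ge0.
  - by apply: emeasurable_funD => //; exact: emeasurable_funM.
  apply: filterS (X_gt0 j) => w Xw _; rewrite -EFinM -EFinD lee_fin.
  have xM : (0 < X j w `^ (- alpha) / M)%R by rewrite divr_gt0// powR_gt0.
  have := powR_le_affine r0 r1 xM; set v := (_ / M)%R.
  have -> : (X j w `^ (- t) = M `^ r * v `^ r)%R.
    rewrite -powRM ?ltW// mulrC divfK ?gt_eqF// -powRrM; congr (_ `^ _)%R.
    by rewrite mulNr /r mulrC divfK// gt_eqF.
  move=> /(ler_wpM2l Mr0) /le_trans; apply.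
  by rewrite mulrDr lerD2l /v -!mulrA (mulrC (X j w `^ _)%R).
rewrite ge0_integralD//; last 2 first.
- by move=> w _; rewrite -EFinM lee_fin mulr_ge0// powR_ge0.
- exact: emeasurable_funM.
rewrite integral_cst//= probability_setT mule1 ge0_integralZl//; last first.
  by move=> w _; rewrite lee_fin powR_ge0.
apply: (@le_trans _ _ ((M `^ r * (1 - r))%:E + (M `^ r * (r / M))%:E * M%:E)).
  by apply: leeD => //; apply: lee_wpmul2l => //; rewrite lee_fin.
rewrite -EFinM -EFinD lee_fin -mulrA divfK ?gt_eqF// -mulrDr subrK mulr1//.
Qed.

(** Each factor has order s / #|A| <= alpha, and the product of the #|A| bounds does not depend on
    [A]. *)
Lemma mean_neg_moment A s : (0 < #|A|)%N -> (0 <= s)%R ->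
  (s <= alpha * #|A|%:R)%R ->
  \int[P]_w ((psum X A w / #|A|%:R) `^ (- s))%:E <= (M `^ (s / alpha))%:E.
Proof.
move=> A0 s0 sA; set k := (#|A|%:R : R)%R.
have k0 : (0 < k :> R)%R by rewrite ltr0n.
pose t := (s / k)%R.
have t0 : (0 <= t)%R by rewrite divr_ge0// ltW.
have ta : (t <= alpha)%R by rewrite ler_pdivrMr.
pose g x := (x `^ (- t))%R.
have mg : measurable_fun setT g by exact: measurable_powR.
have g0 x : (0 <= g x)%R by exact: powR_ge0.
have -> : (M `^ (s / alpha) = (M `^ (t / alpha)) ^+ #|A|)%R.
  rewrite -powR_mulrn ?powR_ge0// -powRrM; congr (_ `^ _)%R.
  by rewrite /t mulrAC divfK// gt_eqF.
apply: (@le_trans _ _ (\int[P]_w (\prod_(i in A) g (X i w))%:E)); last first.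
  apply: integral_prod_le => //; first exact: powR_ge0.
  by move=> j _; apply: lower_neg_moment; rewrite t0.
apply: ae_ge0_le_integral => //.
- by move=> w _; rewrite lee_fin powR_ge0.
- apply/measurable_EFinP/measurable_powRl; apply: measurable_funM => //.
  exact: measurable_psumT.
- by move=> w _; rewrite lee_fin prodr_ge0.
- apply/measurable_EFinP; exact: (measurable_from_sigma mX (@measurable_coord_prod A g mg)).
have : {ae P, forall w, forall j, (0 < X j w)%R} by exact: filter_forall.
apply: filterS => w Xw _; rewrite lee_fin.
by apply: mean_powR_le_prod.
Qed.

Lemma scaled_neg_moment A s m c : (0 < #|A|)%N -> (0 <= s)%R ->
  (s <= alpha * #|A|%:R)%R -> (0 < m)%R -> (0 < c)%R -> (m <= c * #|A|%:R)%R ->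
  \int[P]_w ((psum X A w / m) `^ (- s))%:E <= (c `^ s * M `^ (s / alpha))%:E.
Proof.
move=> A0 s0 sA m0 c0 mc; set k := (#|A|%:R : R)%R.
have k0 : (0 < k :> R)%R by rewrite ltr0n.
have cs0 : (0 <= c `^ s)%R by exact: powR_ge0.
have mk : measurable_fun setT (fun w => ((psum X A w / k) `^ (- s))%:E).
  apply/measurable_EFinP/measurable_powRl; apply: measurable_funM => //.
  exact: measurable_psumT.
apply: (@le_trans _ _ (\int[P]_w ((c `^ s)%:E * ((psum X A w / k) `^ (- s))%:E))).
  apply: ae_ge0_le_integral => //.
  - by move=> w _; rewrite lee_fin powR_ge0.
  - apply/measurable_EFinP/measurable_powRl; apply: measurable_funM => //.
    exact: measurable_psumT.
  - by move=> w _; rewrite -EFinM lee_fin mulr_ge0// powR_ge0.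
  - exact: emeasurable_funM.
  have An0 : A != finset.set0 by rewrite -card_gt0.
  apply: filterS (psum_gt0 X_gt0 An0) => w sw _.
  rewrite -EFinM lee_fin.
  have -> : (c `^ s = c^-1 `^ (- s))%R.
    by rewrite -(powR_inv1 (ltW c0)) -powRrM mulrNN mul1r.
  have ci0 : (0 < c^-1)%R by rewrite invr_gt0.
  have sk0 : (0 < psum X A w / k)%R by exact: divr_gt0.
  rewrite -(powRM _ (ltW ci0) (ltW sk0)).
  apply: ler_powR_neg s0 (mulr_gt0 ci0 sk0) _.
  rewrite mulrC -mulrA -invfM; apply: ler_wpM2l; first exact: ltW.
  by rewrite lef_pV2 ?posrE ?mulr_gt0// mulrC.
rewrite ge0_integralZl//; last by move=> w _; rewrite lee_fin powR_ge0.
by rewrite EFinM; apply: lee_wpmul2l; [rewrite lee_fin|exact: mean_neg_moment].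
Qed.

End negative_moments.

Section second_moments.
Hypothesis X2 : forall j, X j \in Lfun P 2%:E.

Lemma covariance_indep i j : i != j -> fine (covariance P (X i) (X j)) = 0%R.
Proof.
move=> ij; rewrite covariance2E//.
(* The product rule is stated for nonnegative functions, while [X i] is positive only almost surely;
   absolute values bridge the gap. *)
have mnormr : measurable_fun setT (fun x : R => `|x|%R) by exact: normr_measurable.
have ji : j \notin [set i]%SET by rewrite inE eq_sym.
have mi : measurable_fun setT (fun w : sigma_type X [set i]%SET => `|X i w|%R).
  by apply: (measurableT_comp mnormr); apply: measurable_coord; rewrite inE.
have Eabs k : \int[P]_w (X k w)%:E = \int[P]_w (`|X k w|)%:E.
  apply: ae_eq_integral => //.
  - exact/measurable_EFinP.
  - by apply/measurable_EFinP; exact: measurableT_comp.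
  - by apply: filterS (X_gt0 k) => w Xw _; rewrite gtr0_norm.
have EM : \int[P]_w (X i w * X j w)%:E = \int[P]_w (`|X i w| * `|X j w|)%:E.
  apply: ae_eq_integral => //.
  - by apply/measurable_EFinP; exact: measurable_funM.
  - by apply/measurable_EFinP; apply: measurable_funM; exact: measurableT_comp.
  - by apply: filterS2 (X_gt0 i) (X_gt0 j) => w Xi Xj _; rewrite !gtr0_norm.
rewrite EM (integral_mul_indep ji mi (fun _ => normr_ge0 _) mnormr (@normr_ge0 _ _)).
by rewrite -!Eabs subee// fin_numM// (Lfun2_Lfun1_fine (X2 _)).
Qed.

Lemma Lfun2_psum u : psum X u \in Lfun P 2%:E.
Proof. by apply: Lfun2_sum. Qed.

Lemma variance_psum u :
  fine 'V_P[psum X u] = (\sum_(j in u) fine 'V_P[X j])%R.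
Proof.
rewrite /variance [X in covariance P X _](_ : _ = fun w => \sum_(j in u) X j w)%R//.
rewrite covariance_suml// ?Lfun2_psum//; apply: eq_bigr => i iu.
rewrite covarianceC [X in covariance P X _](_ : _ = fun w => \sum_(j in u) X j w)%R//.
rewrite covariance_suml// (bigD1 i)//= big1 ?addr0// => j /andP[_ ji].
exact: covariance_indep.
Qed.

Lemma mean_psum u : fine (\int[P]_w (psum X u w)%:E) =
  (\sum_(j in u) fine (\int[P]_w (X j w)%:E))%R.
Proof.
under eq_integral do rewrite /psum -sumEFin.
rewrite integral_sum//; last first.
  by move=> j; apply/Lfun1_integrable; exact: Lfun21.
by rewrite (eq_bigr _ (fun j _ => Lfun2_Lfun1_fine (X2 j))) sumEFin.
Qed.

End second_moments.

End moments.

(** * From the random sequence to its finite prefixes *)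

Section sequence_facts.
Context {disp : measure_display} {T : measurableType disp} {R : realType}.
Variable P : probability T R.
Local Open Scope ereal_scope.

Lemma finitely_independent_prefix (z : nat -> T -> R) (d : nat) :
  mutually_independent P z -> finitely_independent P (fun j : 'I_d => z j).
Proof.
move=> indep u B mB.
pose B' k := if insub k is Some j then B j else setT.
have mB' k : measurable (B' k) by rewrite /B'; case: insub => [j|]//.
have B'E (j : 'I_d) : B' j = B j by rewrite /B' valK.
pose s := [seq val j | j <- enum u].
have us : uniq s by rewrite map_inj_uniq ?enum_uniq//; exact: val_inj.
have := indep (seq_fset tt s) B' mB'.
rewrite (perm_big s) /=; last by have := seq_fset_perm tt s; rewrite undup_id.
rewrite /s big_map big_enum/= => H.
transitivity (P (\bigcap_(j in [set` seq_fset tt s]) (z j @^-1` B' j))).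
  congr (P _); apply/seteqP; split=> w Hw.
    move=> k kJ; have : k \in s by rewrite -(seq_fsetE tt).
    move=> /mapP[j]; rewrite mem_enum => ju -> /=.
    by rewrite B'E; exact: Hw.
  move=> j /= ju; have := Hw (val j); rewrite /= B'E; apply.
  have js : val j \in s by apply/mapP; exists j => //; rewrite mem_enum.
  by rewrite -(seq_fsetE tt) in js.
by rewrite H; apply: eq_bigr => j _; rewrite B'E.
Qed.

Section negative_moment.
Variables (X : T -> R) (alpha M : R).
Hypotheses (mX : measurable_fun setT X) (alpha_gt0 : (0 < alpha)%R).
Hypothesis X_ge0 : {ae P, forall w, (0 <= X w)%R}.
Hypothesis X_neg : \int[P]_w ((X w `^ alpha)%:E)^-1 <= M%:E.

Let mXa : measurable_fun setT (fun w => (X w `^ alpha)%R).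
Proof. exact: (measurableT_comp (measurable_powR _) mX). Qed.

Let minv : measurable_fun setT (fun w => ((X w `^ alpha)%:E)^-1).
Proof.
rewrite (_ : (fun w => _) = fun w => if (X w `^ alpha)%R == 0%R then +oo
    else (X w `^ (- alpha))%:E); last first.
  by apply/funext => w; rewrite inver powRN.
apply: measurable_fun_ifT => //.
  exact: measurable_fun_eqr.
apply/measurable_EFinP; exact: (measurableT_comp (measurable_powR _) mX).
Qed.

Let inv_ge0 w : 0 <= ((X w `^ alpha)%:E)^-1.
Proof. by rewrite inver; case: ifP => // _; rewrite lee_fin invr_ge0 powR_ge0. Qed.

(** The integrand is +oo wherever [X] vanishes, so its finite integral makes that event null. *)
Lemma neg_moment_gt0 : {ae P, forall w, (0 < X w)%R}.
Proof.
have Iint : P.-integrable setT (fun w => ((X w `^ alpha)%:E)^-1).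
  apply/integrableP; split => //; under eq_integral do rewrite gee0_abs//.
  exact: le_lt_trans X_neg (ltry _).
apply: filterS2 X_ge0 (integrable_ae measurableT Iint) => w X0 /(_ I).
rewrite lt_neqAle X0 andbT inver; case: eqP => // /eqP Xa _.
by apply: contraNneq Xa => <-; rewrite powR0// gt_eqF.
Qed.

Lemma neg_moment_le : \int[P]_w (X w `^ (- alpha))%:E <= M%:E.
Proof.
apply: le_trans X_neg; apply: ge0_le_integral => //.
- by move=> w _; rewrite lee_fin powR_ge0.
- apply/measurable_EFinP; exact: (measurableT_comp (measurable_powR _) mX).
- by move=> w _; rewrite powRN inver; case: ifP => // _; rewrite leey.
Qed.

End negative_moment.

(** [variance] is by definition the integral of the squared deviation, so a finite value already
    puts X - mu in L2. *)
Lemma Lfun2_of_moments (X : T -> R) (mu v : R) : measurable_fun setT X ->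
  'E_P[X] = mu%:E -> 'V_P[X] = v%:E -> X \in Lfun P 2%:E.
Proof.
move=> mX EX VX.
have mXm : measurable_fun setT (fun w => X w - mu)%R by exact: measurable_funB.
have Xm2 : (fun w => X w - mu)%R \in Lfun P 2%:E.
  apply: (Lfun2P mXm); apply: le_lt_trans (ltry v); rewrite -VX.
  by rewrite /variance unlock EX expectationE.
have -> : X = ((fun w => X w - mu) + cst mu)%R.
  by apply/funext => w; rewrite /= [RHS]/GRing.add/= subrK.
by rewrite rpredD ?lee1n//= => _; exact: Lfun_cst.
Qed.

End sequence_facts.

(** Dominates the square of f by integrable terms: the constant serves for p >= 0 and x <= 1, x^2
    for p >= 0 and x >= 1, and for p < 0 the last term is an equality. *)
Lemma sqr_powR_le (R : realType) (x p : R) : 0 < x -> p < 1 ->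
  (x `^ p) ^+ 2 <= 1 + x ^+ 2 + x `^ (- (`|p| * 2)).
Proof.
move=> x0 p1; have x20 := sqr_ge0 x; have xp0 := powR_ge0 x p.
have xq0 := powR_ge0 x (- (`|p| * 2)).
have [p0|p0] := leP 0 p.
  have [x1|/ltW x1] := leP x 1.
    have : x `^ p <= 1 `^ p by apply: ge0_ler_powR; rewrite ?nnegrE ?ler01 ?(ltW x0).
    rewrite powR1 => /(lerXn2r 2 xp0 ler01); rewrite expr1n; lra.
  have : x `^ p <= x by apply: ler1_powR => //; exact: ltW.
  by move=> /(lerXn2r 2 xp0 (ltW x0)); lra.
have -> : (x `^ p) ^+ 2 = x `^ (- (`|p| * 2)); last by lra.
by rewrite ltr0_norm// mulNr opprK powRrM powR_mulrn.
Qed.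

Section elementary_bounds.
Variable R : realFieldType.
Implicit Types e k : R.

Lemma upper_slack e k : 1 + e + e * k + e <= 1 + (2 + k) * e.
Proof. by lra. Qed.

Lemma lower_slack e : 1 - 2 * e <= 1 - e - e.
Proof. by lra. Qed.

Lemma one_sub_ge0 e : 0 < e -> 2 * e < 1 -> 0 <= 1 - e.
Proof. by lra. Qed.

Lemma one_sub_double_gt0 e : 2 * e < 1 -> 0 < 1 - 2 * e.
Proof. by lra. Qed.

End elementary_bounds.

(** * Two-sided estimate for a fixed number of variables *)

Section mean_dimension_bound.
Context {disp : measure_display} {T : measurableType disp} {R : realType}.
Variables (P : probability T R) (n : nat) (X : 'I_n -> T -> R).
Hypothesis mX : forall j, measurable_fun setT (X j).
Hypothesis indep : finitely_independent P X.
Hypothesis X_gt0 : forall j, {ae P, forall w, (0 < X j w)%R}.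
Hypothesis X2 : forall j, X j \in Lfun P 2%:E.
Variables (mu sigma2 : 'I_n -> R) (mu_lo mu_hi sigma2_lo sigma2_hi alpha M p : R).
Hypothesis X_mean : forall j, fine (\int[P]_w (X j w)%:E) = mu j.
Hypothesis X_var : forall j, fine 'V_P[X j]%E = sigma2 j.
Hypothesis mu_bnd : forall j, mu_lo <= mu j <= mu_hi.
Hypothesis sigma2_bnd : forall j, sigma2_lo <= sigma2 j <= sigma2_hi.
Hypotheses (mu_lo_gt0 : 0 < mu_lo) (mu_hi_gt0 : 0 < mu_hi).
Hypotheses (sigma2_lo_gt0 : 0 < sigma2_lo) (sigma2_hi_gt0 : 0 < sigma2_hi).
Hypotheses (alpha_gt0 : 0 < alpha) (M_gt0 : 0 < M).
Hypothesis X_neg_moment : forall j, (\int[P]_w (X j w `^ (- alpha))%:E <= M%:E)%E.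
Hypotheses (p_lt1 : p < 1) (p_neq0 : p != 0) (n_ge2 : (1 < n)%N).

Let m := \sum_(j < n) mu j.
Let h := pow_mean m p.
Let rest := leave_one_out X m.

Let n_gt0 : 0 < n%:R :> R. Proof. by rewrite ltr0n ltnW. Qed.

Let m_ge : mu_lo * n%:R <= m.
Proof.
rewrite mulr_natr -[n in _ *+ n]card_ord -sumr_const; apply: ler_sum => j _.
by have /andP[] := mu_bnd j.
Qed.

Let m_le : m <= mu_hi * n%:R.
Proof.
rewrite mulr_natr -[n in _ *+ n]card_ord -sumr_const; apply: ler_sum => j _.
by have /andP[] := mu_bnd j.
Qed.

Let m_gt0 : 0 < m.
Proof. by apply: lt_le_trans m_ge; exact: mulr_gt0. Qed.

(** Bound on negative moments of order s, uniform in n and j. The 2 pays for the omitted variable: m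
    <= mu_hi n <= 2 mu_hi (n - 1) when n >= 2. *)
Let K s : R := (2 * mu_hi) `^ s * M `^ (s / alpha).

Let c0 : 0 < 2 * mu_hi. Proof. exact: mulr_gt0. Qed.

Let cardT : #|[set: 'I_n]%SET| = n. Proof. by rewrite cardsT card_ord. Qed.

Let cardC1 j : #|~: [set j] : {set 'I_n}| = n.-1.
Proof. by rewrite cardsC1 card_ord. Qed.

Let n1_ge : n%:R <= 2 * n.-1%:R :> R.
Proof.
have n0 := ltnW n_ge2.
by rewrite -natrM ler_nat mul2n -addnn -{1}(prednK n0) -addn1 leq_add2l -ltnS prednK.
Qed.

Let neg_rest j s : 0 <= s -> s <= alpha * n.-1%:R ->
  (\int[P]_w (rest j w `^ (- s))%:E <= (K s)%:E)%E.
Proof.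
move=> s0 sn; have A0 : (0 < #|~: [set j] : {set 'I_n}|)%N.
  by rewrite cardC1 -ltnS prednK// ltnW.
apply: (scaled_neg_moment mX indep X_gt0 alpha_gt0 M_gt0 X_neg_moment A0 s0 _ m_gt0 c0).
  by rewrite cardC1.
apply: le_trans m_le _; rewrite cardC1 (mulrC 2) -mulrA.
by apply: ler_wpM2l n1_ge; exact: ltW.
Qed.

Let neg_total s : 0 <= s -> s <= alpha * n%:R ->
  (\int[P]_w ((psum X [set: 'I_n]%SET w / m) `^ (- s))%:E <= (K s)%:E)%E.
Proof.
move=> s0 sn; have A0 : (0 < #|[set: 'I_n]%SET|)%N by rewrite cardT ltnW.
apply: (scaled_neg_moment mX indep X_gt0 alpha_gt0 M_gt0 X_neg_moment A0 s0 _ m_gt0 c0).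
  by rewrite cardT.
apply: le_trans m_le _; rewrite cardT (mulrC 2) -mulrA.
by apply: ler_wpM2l; [exact: ltW|rewrite ler_peMl ?ler1n// ltW].
Qed.

Let L : R := (sigma2_hi + mu_hi ^+ 2) / mu_lo ^+ 2.

(** Variance plus squared bias: leaving out [X j] shifts the mean by - mu_j / m. Both parts are at
    most of order n / m^2, and m >= mu_lo n. *)
Lemma rest_second_moment j :
  (\int[P]_w ((rest j w - 1) ^+ 2)%:E <= (L / n%:R)%:E)%E.
Proof.
set u := ~: [set j] : {set 'I_n}.
have E w : (rest j w - 1) ^+ 2 = (m ^- 2) * (psum X u w - m) ^+ 2.
  rewrite -exprVn -exprMn; congr (_ ^+ 2).
  by rewrite /rest /leave_one_out mulrBr mulVf ?gt_eqF// mulrC.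
under eq_integral do rewrite E EFinM.
have mu' : measurable_fun setT (fun w => ((psum X u w - m) ^+ 2)%:E).
  apply/measurable_EFinP; apply: measurable_funX; apply: measurable_funB => //.
  exact: measurable_psumT.
rewrite (ge0_integralZl _ measurableT mu'); last 2 first.
- by move=> w _; rewrite lee_fin sqr_ge0.
- by rewrite lee_fin invr_ge0 sqr_ge0.
rewrite (integral_sqrB _ (Lfun2_psum X2 u)) -EFinM lee_fin.
rewrite (variance_psum mX indep X_gt0 X2) (mean_psum X2).
rewrite (eq_bigr _ (fun j _ => X_mean j)) (eq_bigr _ (fun j _ => X_var j)).
have -> : \sum_(i in u) mu i - m = - mu j.
  rewrite /m [X in _ - X](bigD1 j)//= [X in X - _](eq_bigl (fun i => i != j)).
    by rewrite opprD addrCA subrr addr0.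
  by move=> i; rewrite !inE.
rewrite sqrrN.
have hv : \sum_(i in u) sigma2 i <= sigma2_hi * n%:R.
  apply: (@le_trans _ _ (\sum_(i in u) sigma2_hi)).
    by apply: ler_sum => i _; have /andP[] := sigma2_bnd i.
  rewrite sumr_const cardC1 mulr_natr ler_wpMn2l// ?ltW// leq_pred//.
have hm : mu j ^+ 2 <= mu_hi ^+ 2 * n%:R.
  apply: (@le_trans _ _ (mu_hi ^+ 2)); last by rewrite ler_peMr ?sqr_ge0// ler1n ltnW.
  have /andP[mlo mhi] := mu_bnd j; have mj0 := le_trans (ltW mu_lo_gt0) mlo.
  by rewrite lerXn2r// nnegrE// ltW.
have hmm : (mu_lo * n%:R) ^+ 2 <= m ^+ 2.
  by rewrite lerXn2r// nnegrE ltW// mulr_gt0.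
have hmi : m ^- 2 <= (mu_lo * n%:R) ^- 2.
  by rewrite lef_pV2 ?posrE ?exprn_gt0// mulr_gt0.
have s0 : 0 <= \sum_(i in u) sigma2 i + mu j ^+ 2.
  rewrite addr_ge0 ?sqr_ge0// sumr_ge0// => i _.
  by have /andP[h1 _] := sigma2_bnd i; apply: le_trans h1; exact: ltW.
apply: (@le_trans _ _ ((mu_lo * n%:R) ^- 2 * ((sigma2_hi + mu_hi ^+ 2) * n%:R))).
  apply: ler_pM => //; first by rewrite invr_ge0 sqr_ge0.
  by rewrite mulrDl lerD.
rewrite le_eqVlt; apply/orP; left; apply/eqP; rewrite /L; field.
by rewrite !gt_eqF.
Qed.

Hypothesis p_n : `|p| * 2 <= alpha * n%:R.

(** For negative p this rests on the negative moment of order 2 |p|, which [p_n] makes available. *)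
Lemma total_finite : (\int[P]_w (total X h w ^+ 2)%:E < +oo)%E.
Proof.
pose Y w := psum X [set: 'I_n]%SET w / m.
have mY : measurable_fun setT Y.
  by apply: measurable_funM => //; exact: measurable_psumT.
have mYp t : measurable_fun setT (fun w => (Y w `^ t)%:E).
  by apply/measurable_EFinP; exact: measurable_powRl.
have mY2 : measurable_fun setT (fun w => (Y w ^+ 2)%:E).
  by apply/measurable_EFinP; exact: measurable_funX.
have Y2 : Y \in Lfun P 2%:E.
  have -> : Y = (m^-1 \o* psum X [set: 'I_n]%SET) by [].
  by apply: Lfun_scale; [rewrite ler1n|exact: Lfun2_psum].
have pn0 : 0 <= `|p| * 2 by rewrite mulr_ge0.
apply: (@le_lt_trans _ _ (\int[P]_w ((1 + Y w ^+ 2)%:E + (Y w `^ (- (`|p| * 2)))%:E))%E).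
  apply: ae_ge0_le_integral => //.
  - by move=> w _; rewrite lee_fin sqr_ge0.
  - apply/measurable_EFinP; apply: measurable_funX.
    exact: measurable_total (@measurable_pow_mean _ m p).
  - by move=> w _; rewrite -EFinD lee_fin !addr_ge0 ?sqr_ge0 ?powR_ge0.
  - apply: emeasurable_funD => //; apply/measurable_EFinP; apply: measurable_funD => //.
    exact: measurable_funX.
  have Tn0 : [set: 'I_n]%SET != finset.set0 by rewrite -card_gt0 cardT ltnW.
  apply: filterS (psum_gt0 X_gt0 Tn0) => w sw _.
  rewrite -EFinD lee_fin; apply: sqr_powR_le => //; exact: divr_gt0.
have m1 : measurable_fun setT (fun w => (1 + Y w ^+ 2)%:E).
  by apply/measurable_EFinP; apply: measurable_funD => //; exact: measurable_funX.
have p1 w : (0 <= (1 + Y w ^+ 2)%:E)%E by rewrite lee_fin addr_ge0 ?sqr_ge0.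
have p2 w : (0 <= (Y w `^ (- (`|p| * 2)))%:E)%E by rewrite lee_fin powR_ge0.
have p3 w : (0 <= (Y w ^+ 2)%:E)%E by rewrite lee_fin sqr_ge0.
have p4 (w : T) : (0 <= 1%:E :> \bar R)%E by rewrite lee_fin.
rewrite (ge0_integralD _ measurableT (fun w _ => p1 w) m1 (fun w _ => p2 w) (mYp _)).
under eq_integral do rewrite EFinD.
rewrite (ge0_integralD _ measurableT (fun w _ => p4 w) (measurable_cst _) (fun w _ => p3 w) mY2).
rewrite integral_cst//= probability_setT mule1.
apply: lte_add_pinfty; last exact: le_lt_trans (neg_total pn0 p_n) (ltry _).
by apply: lte_add_pinfty; [exact: ltry|exact: (Lfun2_lty Y2)].
Qed.

Variables (e C1 C2 : R).
Hypotheses (e_gt0 : 0 < e) (e_lt : 2 * e < 1) (C1_ge0 : 0 <= C1) (C2_ge0 : 0 <= C2).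
Hypothesis C1P : forall y, 0 < y ->
  Num.max 1 (y `^ (- ((1 - p) * 2))) <=
  1 + e + e * y `^ (- ((1 - p) * 2 * 2)) + C1 * (y - 1) ^+ 2.
Hypothesis C2P : forall y, 0 < y ->
  1 - e - C2 * (y - 1) ^+ 2 <= Num.min 1 (y `^ (- (1 - p))).
Hypotheses (n_C1 : C1 * L <= e * n%:R) (n_C2 : C2 * L <= e * n%:R).
Hypothesis n_q : (1 - p) * 2 * 2 <= alpha * n.-1%:R.

Let C_le C : 0 <= C -> C * L <= e * n%:R -> C * (L / n%:R) <= e.
Proof. by move=> C0 H; rewrite mulrA ler_pdivrMr. Qed.

Let mrest j : measurable_fun setT (rest j).
Proof. exact: measurable_rest. Qed.

Let mrest1 j (C : R) : measurable_fun setT (fun w => (C * (rest j w - 1) ^+ 2)%:E).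
Proof.
apply/measurable_EFinP; apply: measurable_funM => //.
by apply: measurable_funX; exact: measurable_funB.
Qed.

Let integral_rest1 j C : 0 <= C -> C * L <= e * n%:R ->
  (\int[P]_w (C * (rest j w - 1) ^+ 2)%:E <= e%:E)%E.
Proof.
move=> C0 H; under eq_integral do rewrite EFinM.
have := mrest1 j 1; under eq_fun do rewrite mul1r.
move=> m1; rewrite (ge0_integralZl _ measurableT m1); last 2 first.
- by move=> w _; rewrite lee_fin sqr_ge0.
- by rewrite lee_fin.
apply: (@le_trans _ _ (C%:E * (L / n%:R)%:E)%E).
  by apply: lee_wpmul2l (rest_second_moment j); rewrite lee_fin.
by rewrite -EFinM lee_fin; exact: C_le.
Qed.

(** In [a], one e comes from the truncation, one from the Chebyshev term C1 L / n, and K e from the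
    negative moment of order 4 (1 - p). In [b], one e is the truncation and one the Chebyshev
    term. *)
Let a := 1 + (2 + K ((1 - p) * 2 * 2)) * e.
Let b := 1 - 2 * e.

Let upper j : (\int[P]_w (Num.max 1 (rest j w `^ (- ((1 - p) * 2))))%:E <= a%:E)%E.
Proof.
set q := (1 - p) * 2.
have q0 : 0 <= q * 2 by rewrite !mulr_ge0// subr_ge0 ltW.
have mp : measurable_fun setT (fun w => (rest j w `^ (- (q * 2)))%:E).
  by apply/measurable_EFinP; exact: measurable_powRl.
have p0 w : (0 <= (rest j w `^ (- (q * 2)))%:E)%E by rewrite lee_fin powR_ge0.
have e0 : 0 <= e by exact: ltW.
have p1 (w : T) : (0 <= (1 + e)%:E :> \bar R)%E by rewrite lee_fin addr_ge0.
have p2 w : (0 <= e%:E * (rest j w `^ (- (q * 2)))%:E)%E by rewrite mule_ge0// lee_fin.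
have p3 w : (0 <= (C1 * (rest j w - 1) ^+ 2)%:E)%E by rewrite lee_fin mulr_ge0 ?sqr_ge0.
have p4 w : (0 <= (1 + e)%:E + e%:E * (rest j w `^ (- (q * 2)))%:E)%E.
  exact: adde_ge0 (p1 w) (p2 w).
have m2 : measurable_fun setT (fun w => e%:E * (rest j w `^ (- (q * 2)))%:E)%E.
  exact: emeasurable_funM.
have m3 : measurable_fun setT (fun w => (1 + e)%:E + e%:E * (rest j w `^ (- (q * 2)))%:E)%E.
  exact: emeasurable_funD.
have p5 w : (0 <= (Num.max 1 (rest j w `^ (- q)))%:E)%E by rewrite lee_fin le_max ler01.
have p6 w : (0 <= (1 + e)%:E + e%:E * (rest j w `^ (- (q * 2)))%:E +
    (C1 * (rest j w - 1) ^+ 2)%:E)%E by exact: adde_ge0 (p4 w) (p3 w).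
have m4 : measurable_fun setT (fun w => (Num.max 1 (rest j w `^ (- q)))%:E).
  by apply/measurable_EFinP; apply: measurable_maxr => //; exact: measurable_powRl.
have m5 : measurable_fun setT (fun w => (1 + e)%:E + e%:E * (rest j w `^ (- (q * 2)))%:E +
    (C1 * (rest j w - 1) ^+ 2)%:E)%E.
  exact: (emeasurable_funD m3 (mrest1 j C1)).
apply: (@le_trans _ _ (\int[P]_w ((1 + e)%:E + e%:E * (rest j w `^ (- (q * 2)))%:E +
   (C1 * (rest j w - 1) ^+ 2)%:E))%E).
  apply: (ae_ge0_le_integral measurableT (fun w _ => p5 w) m4 (fun w _ => p6 w) m5).
  apply: filterS (rest_gt0 X_gt0 m_gt0 n_ge2 j) => w rw _.
  by rewrite -EFinM -!EFinD lee_fin; exact: C1P.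
rewrite (ge0_integralD _ measurableT (fun w _ => p4 w) m3 (fun w _ => p3 w) (mrest1 j C1)).
rewrite (ge0_integralD _ measurableT (fun w _ => p1 w) (measurable_cst _) (fun w _ => p2 w) m2).
rewrite integral_cst//= probability_setT mule1.
rewrite (ge0_integralZl _ measurableT mp (fun w _ => p0 w)) ?lee_fin//.
apply: (@le_trans _ _ ((1 + e)%:E + e%:E * (K (q * 2))%:E + e%:E)%E).
  apply: leeD; last exact: integral_rest1.
  apply: leeD => //; apply: lee_wpmul2l; first by rewrite lee_fin.
  exact: neg_rest.
by rewrite -EFinM -!EFinD lee_fin /a -/q; exact: upper_slack.
Qed.

Let lower j : (b%:E <= \int[P]_w (Num.min 1 (rest j w `^ (- (1 - p))))%:E)%E.
Proof.
pose k w := Num.min 1 (rest j w `^ (- (1 - p))).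
have k0 w : 0 <= k w by rewrite le_min ler01 powR_ge0.
have mk : measurable_fun setT (fun w => (k w)%:E).
  by apply/measurable_EFinP; apply: measurable_minr => //; exact: measurable_powRl.
(* The quadratic term is moved to the side of the minimum, so that only nonnegative functions are
   integrated. *)
suff H : ((1 - e)%:E <= \int[P]_w (k w)%:E + e%:E)%E.
  by move: H; rewrite -leeBlDr// -EFinB => /(le_trans _); apply; rewrite lee_fin; exact: lower_slack.
have p1 w : (0 <= (k w)%:E)%E by rewrite lee_fin.
have p2 w : (0 <= (C2 * (rest j w - 1) ^+ 2)%:E)%E.
  by rewrite lee_fin mulr_ge0 ?sqr_ge0.
have p3 (w : T) : (0 <= (1 - e)%:E :> \bar R)%E by rewrite lee_fin one_sub_ge0.
have p4 w : (0 <= (k w)%:E + (C2 * (rest j w - 1) ^+ 2)%:E)%E.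
  exact: adde_ge0 (p1 w) (p2 w).
have m4 := emeasurable_funD mk (mrest1 j C2).
apply: (@le_trans _ _ (\int[P]_w ((k w)%:E + (C2 * (rest j w - 1) ^+ 2)%:E))%E); last first.
  rewrite (ge0_integralD _ measurableT (fun w _ => p1 w) mk (fun w _ => p2 w) (mrest1 j C2)).
  by apply: leeD => //; exact: integral_rest1.
have -> : (1 - e)%:E = (\int[P]_w (cst (1 - e)%:E w))%E :> \bar R.
  by rewrite integral_cst//= probability_setT mule1.
apply: (ae_ge0_le_integral measurableT (fun w _ => p3 w) (measurable_cst _) (fun w _ => p4 w) m4).
apply: filterS (rest_gt0 X_gt0 m_gt0 n_ge2 j) => w rw _.
by rewrite -EFinD lee_fin -lerBlDr; exact: C2P.
Qed.

Let mh : measurable_fun setT h. Proof. exact: measurable_pow_mean. Qed.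
Let h0 s : 0 <= h s. Proof. exact: pow_mean_ge0. Qed.

Let v j := fine 'V_P[marginal X m p j]%E.

Let v_gt0 j : 0 < v j.
Proof.
apply: (variance_marginal_gt0 mX X_gt0 X2 m_gt0 p_neq0 p_lt1).
by rewrite X_var; have /andP[+ _] := sigma2_bnd j; apply: lt_le_trans.
Qed.

Let sum_v_gt0 : 0 < \sum_(j < n) v j.
Proof.
rewrite (bigD1 (Ordinal (ltnW n_ge2)))//= ltr_pwDl ?v_gt0// sumr_ge0// => j _.
exact: ltW.
Qed.

Let b_gt0 : 0 < b. Proof. exact: one_sub_double_gt0. Qed.

Let tot2 := total_finite.

Lemma cvar_total_ge : b ^+ 2 * \sum_(j < n) v j <= cvar P X h [set: 'I_n]%SET.
Proof.
(* [sum_cvar1_le] is proved through the ANOVA effects of some function of the sum; this one is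
   supplied as witness. *)
pose f (x : 'I_n -> R) := h (\sum_j x j).
apply: le_trans (sum_cvar1_le mX indep mh h0 tot2 (f := f) (fun=> erefl)).
rewrite mulr_sumr; apply: ler_sum => j _.
exact: (cvar1_ge mX indep X_gt0 X2 m_gt0 p_neq0 p_lt1 n_ge2 tot2 b_gt0 (lower j)).
Qed.

Lemma cvar_total_gt0 : 0 < cvar P X h [set: 'I_n]%SET.
Proof.
apply: lt_le_trans cvar_total_ge; apply: mulr_gt0 sum_v_gt0.
by rewrite exprn_gt0.
Qed.

(** The numerator is at most [a] times the sum of the [v j], the variance at least [b ^+ 2] times
    the same sum. *)
Lemma mean_dimension_le (f : ('I_n -> R) -> R) : (forall x, f x = h (\sum_j x j)) ->
  mean_dimension P X f <= a / b ^+ 2.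
Proof.
move=> fE; rewrite (mean_dimensionE mX indep mh h0 tot2 fE).
have V0 := cvar_total_gt0; have b20 : 0 < b ^+ 2 by rewrite exprn_gt0.
have a0 : 0 <= a.
  rewrite /a addr_ge0// mulr_ge0 ?(ltW e_gt0)// addr_ge0// /K.
  by rewrite mulr_ge0 ?powR_ge0.
have H : \sum_(j < n) (cvar P X h [set: 'I_n]%SET - cvar P X h (~: [set j])) <=
    a * \sum_(j < n) v j.
  rewrite mulr_sumr; apply: ler_sum => j _.
  exact: (cvar_drop_le mX indep X_gt0 X2 m_gt0 p_neq0 p_lt1 n_ge2 tot2 (upper j)).
rewrite ler_pdivrMl//; apply: le_trans H _.
rewrite mulrCA; apply: (ler_wpM2l a0).
by rewrite (ler_pdivlMr _ _ b20) mulrC cvar_total_ge.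
Qed.

End mean_dimension_bound.

(** * Choice of constants and passage to the limit *)

Lemma ratio_bound (R : realFieldType) (K eps : R) : 0 <= K -> 0 < eps ->
  exists e, [/\ 0 < e, 2 * e < 1 &
    (1 + (2 + K) * e) / (1 - 2 * e) ^+ 2 <= 1 + eps].
Proof.
(* Clearing the denominator and dropping the term in e^2 leaves (6 + K + 4 eps) e <= eps, which e =
   eps / c ensures. The part 8 eps of [c] gives 8 e <= 1, hence 2 e < 1. *)
move=> K0 eps0; pose c := 8 + K + 8 * eps; have c0 : 0 < c by rewrite /c; lra.
pose e := eps / c; have e0 : 0 < e by rewrite divr_gt0.
have ec : e * c = eps by rewrite divfK// gt_eqF.
have eK : 0 <= e * K by rewrite mulr_ge0// ltW.
have ee : 0 < e * eps by rewrite mulr_gt0.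
have e2 : 0 <= e ^+ 2 * (1 + eps) by rewrite mulr_ge0 ?sqr_ge0//; lra.
have ecE : e * c = 8 * e + e * K + 8 * (e * eps) by rewrite /c; ring.
have e18 : 8 * e <= 1.
  have : (8 * e) * eps <= 1 * eps by lra.
  by rewrite ler_pM2r.
exists e; split => //; first lra.
rewrite ler_pdivrMr; last by rewrite exprn_gt0//; lra.
have -> : (1 + eps) * (1 - 2 * e) ^+ 2 =
  1 + eps - 4 * e - 4 * (e * eps) + 4 * (e ^+ 2 * (1 + eps)) by ring.
lra.
Qed.

(* The extended inverse satisfies 0^-1 = +oo, so the negative moment hypothesis
   excludes an atom of [z j] at 0. *)
Theorem theorem2 (disp : measure_display) (T : measurableType disp)
    (R : realType) (P : probability T R) (z : nat -> {RV P >-> R})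
    (mu sigma2 : nat -> R) (mu_lo mu_hi sigma2_lo sigma2_hi alpha M p : R)
    (z_indep : mutually_independent P (fun j => z j))
    (z_ge0 : forall j, {ae P, forall w, 0 <= z j w})
    (z_mean : forall j, 'E_P[z j]%E = (mu j)%:E)
    (z_var : forall j, 'V_P[z j]%E = (sigma2 j)%:E)
    (mu_lo_gt0 : 0 < mu_lo) (mu_lo_le_hi : mu_lo <= mu_hi)
    (sigma2_lo_gt0 : 0 < sigma2_lo) (sigma2_lo_le_hi : sigma2_lo <= sigma2_hi)
    (alpha_gt0 : 0 < alpha)
    (mu_bnd : forall j, mu_lo <= mu j <= mu_hi)
    (sigma2_bnd : forall j, sigma2_lo <= sigma2 j <= sigma2_hi)
    (neg_moment : forall j,
       (\int[P]_w ((z j w `^ alpha)%:E)^-1 <= M%:E)%E)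
    (p_lt1 : p < 1) (p_neq0 : p != 0) :
  let Z := fun (d : nat) (j : 'I_d) => (z j : T -> R) in
  let f := fun d : nat => power_of_sum mu p (n := d) in
  (\forall d \near \oo, (0 < 'V_P[eval_at (Z d) (f d)] < +oo)%E) /\
  mean_dimension P (Z d) (f d) @[d --> \oo] --> (1 : R).
Proof.
move=> Z f.
have mu_hi_gt0 := lt_le_trans mu_lo_gt0 mu_lo_le_hi.
have sigma2_hi_gt0 := lt_le_trans sigma2_lo_gt0 sigma2_lo_le_hi.
(* The interpolation of moments divides by the bound, so a positive one is taken. *)
pose M' := `|M| + 1; have M'_gt0 : 0 < M' by rewrite /M' ltr_wpDl.
have mz j : measurable_fun setT (z j : T -> R) by [].
have z_gt0 j : {ae P, forall w, 0 < z j w}.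
  exact: neg_moment_gt0 (mz j) alpha_gt0 (z_ge0 j) (neg_moment j).
have z2 j : (z j : T -> R) \in Lfun P 2%:E.
  exact: Lfun2_of_moments (mz j) (z_mean j) (z_var j).
have zM j : (\int[P]_w (z j w `^ (- alpha))%:E <= M'%:E)%E.
  apply: le_trans (neg_moment_le (mz j) (neg_moment j)) _.
  by rewrite lee_fin /M' (le_trans (ler_norm M))// lerDl.
have zmean j : fine (\int[P]_w (z j w)%:E)%E = mu j by rewrite -expectationE z_mean.
have zvar j : fine 'V_P[z j]%E = sigma2 j by rewrite z_var.
pose q := (1 - p) * 2.
have p10 : 0 < 1 - p by rewrite subr_gt0.
have q0 : 0 < q by rewrite mulr_gt0.
(* This constant depends neither on d nor on eps, so e can be fixed before d. *)
pose K := (2 * mu_hi) `^ (q * 2) * M' `^ (q * 2 / alpha).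
have K0 : 0 <= K by rewrite mulr_ge0 ?powR_ge0.
pose L := (sigma2_hi + mu_hi ^+ 2) / mu_lo ^+ 2.
have main eps : 0 < eps -> \forall d \near \oo,
    (0 < 'V_P[eval_at (Z d) (f d)] < +oo)%E /\
    1 <= mean_dimension P (Z d) (f d) <= 1 + eps.
  (* Order of choice: e from eps and [K], then C1 and C2 from e, and last d, large enough to absorb
     C1, C2 and the orders of the negative moments. *)
  move=> eps0; have [e [e0 e1 He]] := ratio_bound K0 eps0.
  have [C1 C10 C1P] := max1_powR_le q0 e0.
  have e_lt1 : e < 1 by lra.
  have [C2 C20 C2P] := min1_powR_ge p10 e0 e_lt1.
  near=> d.
  have d2 : (1 < d)%N by near: d; exact: nbhs_infty_gt.
  have n_p : `|p| * 2 <= alpha * d%:R.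
    by rewrite [leRHS]mulrC -ler_pdivrMr//; near: d; exact: nbhs_infty_ger.
  have n_C1 : C1 * L <= e * d%:R.
    by rewrite [leRHS]mulrC -ler_pdivrMr//; near: d; exact: nbhs_infty_ger.
  have n_C2 : C2 * L <= e * d%:R.
    by rewrite [leRHS]mulrC -ler_pdivrMr//; near: d; exact: nbhs_infty_ger.
  have n_q : q * 2 <= alpha * d.-1%:R.
    rewrite [leRHS]mulrC -ler_pdivrMr// -subn1 natrB ?(ltnW d2)// lerBrDr.
    by near: d; exact: nbhs_infty_ger.
  have indep := @finitely_independent_prefix _ _ _ P _ d z_indep.
  have mZ (j : 'I_d) := mz j.
  have Z_gt0 (j : 'I_d) := z_gt0 j.
  have Z2 (j : 'I_d) := z2 j.
  have ZM (j : 'I_d) := zM j.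
  have Zmean (j : 'I_d) := zmean j.
  have Zvar (j : 'I_d) := zvar j.
  have mub (j : 'I_d) := mu_bnd j.
  have sb (j : 'I_d) := sigma2_bnd j.
  pose h := pow_mean (\sum_(j < d) mu j) p.
  have mh : measurable_fun setT h := @measurable_pow_mean _ _ _.
  have h0 s : 0 <= h s := pow_mean_ge0 _ _ s.
  have fE x : f d x = h (\sum_j x j) by [].
  have tot := total_finite mZ indep Z_gt0 Z2 mub mu_lo_gt0 mu_hi_gt0 alpha_gt0
    M'_gt0 ZM p_lt1 d2 n_p.
  have V0 := cvar_total_gt0 mZ indep Z_gt0 Z2 Zmean Zvar mub sb mu_lo_gt0 mu_hi_gt0
    sigma2_lo_gt0 sigma2_hi_gt0 alpha_gt0 M'_gt0 ZM p_lt1 p_neq0 d2 n_p e0 e1 C20 C2P n_C2.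
  have le := mean_dimension_le mZ indep Z_gt0 Z2 Zmean Zvar mub sb mu_lo_gt0 mu_hi_gt0
    sigma2_lo_gt0 sigma2_hi_gt0 alpha_gt0 M'_gt0 ZM p_lt1 p_neq0 d2 n_p e0 e1
    C10 C20 C1P C2P n_C1 n_C2 n_q fE.
  split.
    by rewrite (variance_total mZ indep mh h0 tot fE) lte_fin V0 ltry.
  rewrite (mean_dimension_ge1 mZ indep mh h0 tot fE V0)/=.
  exact: le_trans le He.
split.
  by apply: filterS (main 1 ltr01) => d [].
apply/cvgrPdist_le => eps eps0.
apply: filterS (main eps eps0) => d [_ /andP[h1 h2]].
by rewrite ler_distlC; apply/andP; split; [lra|].
Unshelve. all: by end_near.
Qed.
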